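(* Let $M$ be a smooth $n$-dimensional manifold and let $N\neq n$. Under the flow of metrics $g=g(t)$ and functions $f=f(t)$ on $M$ given by $$\frac{\partial}{\partial t} g = -2\,\mathrm{Ric}_f^N,\qquad \frac{\partial}{\partial t} f = \Delta_f f,$$ the following evolution formulas hold, where $\overline{\mathrm{Ric}}=\mathrm{Ric}_f^N$ and $\bar S=g^{ij}\overline{\mathrm{Ric}}_{ij}$: $$\begin{aligned} \frac{\partial}{\partial t} \mathrm{Ric}_{jk} &= \Delta\mathrm{Ric}_{jk} + 2R_{pjkq}\mathrm{Ric}^{pq} - 2\mathrm{Ric}_j^p\mathrm{Ric}_{pk} - (\nabla^\lambda\mathrm{Ric}_{jk})\nabla_\lambda f - \mathrm{Ric}_j^\lambda\nabla_k\nabla_\lambda f - \mathrm{Ric}_k^\lambda\nabla_j\nabla_\lambda f\\ &\qquad +\frac{2}{N-n}\left[\Delta f\, \nabla_j\nabla_k f - \nabla_p\nabla_j f\,\nabla^p\nabla_k f - R_{pjk}{}^{\lambda}\nabla_\lambda f\,\nabla^p f\right], \end{aligned}$$ $$\begin{aligned} \frac{\partial}{\partial t}\overline{\mathrm{Ric}}_{jk} &= \Delta\overline{\mathrm{Ric}}_{jk} + 2R_{pjkq}\overline{\mathrm{Ric}}^{pq} -2\overline{\mathrm{Ric}}_j^p\,\overline{\mathrm{Ric}}_{pk} - (\nabla^p \overline{\mathrm{Ric}}_{jk})\nabla_p f\\ &\qquad - \frac{1}{N-n}\Big[\overline{\mathrm{Ric}}_{jp}\nabla^p f\nabla_k f +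 \overline{\mathrm{Ric}}_{kp}\nabla^p f\nabla_j f - 2\left(\Delta f - |\nabla f|^2\right) \nabla_j\nabla_k f \Big]\\ &= \Delta_f\overline{\mathrm{Ric}}_{jk} + 2R_{pjkq}\overline{\mathrm{Ric}}^{pq} -2\overline{\mathrm{Ric}}_j^p\,\overline{\mathrm{Ric}}_{pk}\\ &\qquad - \frac{1}{N-n}\Big[\overline{\mathrm{Ric}}_{jp}\nabla^p f\nabla_k f + \overline{\mathrm{Ric}}_{kp}\nabla^p f\nabla_j f - 2\left(\Delta f - |\nabla f|^2\right) \nabla_j\nabla_k f \Big], \end{aligned}$$ $$\begin{aligned} \frac{\partial}{\partial t} \bar{S} &= \Delta \bar S + 2|\overline{\mathrm{Ric}}|^2 - 2\langle \overline{\mathrm{Ric}}, \mathrm{Hess}\, f\rangle - df(\nabla\bar S) + \frac{2}{N-n}\Delta f\Big[\Delta f - |\nabla f|^2\Big]\\ &= \Delta_f \bar{S} + 2|\overline{\mathrm{Ric}}|^2 - 2\langle\overline{\mathrm{Ric}},\mathrm{Hess}\, f\rangle + \frac{2}{N-n}\Delta f\Big[\Delta f - |\nabla f|^2\Big]. \end{aligned}$$ Furthermore, for a constant $k$, the function $\tilde{S}_k = \bar{S} + \Delta_f f - k|\nabla f|^2 = \bar{S} + \Delta f - (k+1)|\nabla f|^2$ satisfies $$\frac{\partial}{\partial t}\tilde{S}_k = \Delta_f\tilde{S}_k + 2|\overline{\mathrm{Ric}}|^2 + \frac{2}{N-n}\Big[\Delta f - |\nabla f|^2\Big]^2 + 2k|\mathrm{Hess}\,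 f|^2 + \frac{2k}{N-n}|\nabla f|^4 .$$
   Context: For a metric $g$ and a smooth function $f$ on the $n$-manifold $M$, the Bakry-\'Emery Ricci tensor is $\mathrm{Ric}_f^N=\mathrm{Ric}+\mathrm{Hess}\,f-\frac{df\otimes df}{N-n}$ (for $N=\infty$ one sets $\frac{1}{N-n}=0$). All geometric quantities ($\mathrm{Ric}$, $\nabla$, $\Delta$, curvature, norms, index raising) are those of $g=g(t)$, with $\Delta=g^{ij}\nabla_i\nabla_j$. The drift Laplacian is $\Delta_f u=\Delta u-df(\nabla u)$ on functions, and on tensors $\Delta_f T=\Delta T-\nabla_{\nabla f}T$. The Riemann tensor sign convention is such that $\mathrm{Ric}_{jk}=g^{pq}R_{pjkq}$, and $R_{pjk}{}^{\lambda}=g^{\lambda q}R_{pjkq}$. Repeated indices are summed. *)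

(* Defs.v *)
From HB Require Import structures.
From mathcomp Require Import all_boot all_order all_algebra.
From mathcomp Require Import all_classical all_reals all_analysis.

Set Implicit Arguments.
Unset Strict Implicit.
Unset Printing Implicit Defensive.

Import Order.TTheory GRing.Theory Num.Theory.
Import numFieldNormedType.Exports.

Local Open Scope classical_set_scope.
Local Open Scope ring_scope.

(* MathComp-Analysis has no manifolds, so they
   are built here from charts. A tensor field is given by its components in
   every chart of the atlas, subject to the usual transformation law, and the
   geometric quantities of a metric are given by their component formulas. *)

(* [Ck m O F]: on the open set [O], the iterated directional derivatives of
   [F] up to order [m] exist and are continuous. On a finite-dimensional space
   this is the usual class C^m. *)
Fixpoint Ck (R : realType) (E : normedModType R) (m : nat) (O : set E)
    (F : E -> R) : Prop :=
  (forall x, O x -> {for x, continuous F}) /\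
  (if m is m'.+1 then
     forall v : E, (forall x, O x -> derivable F x v) /\ Ck m' O ('D_v F)
   else True).

Definition smooth_on (R : realType) (E : normedModType R) (O : set E)
    (F : E -> R) : Prop :=
  forall m, Ck m O F.

(** * Smooth manifolds *)

(* [cinv] is the inverse of [cmap] on the coordinate domain
   [cmap @` cdom]; its values elsewhere are irrelevant. *)
Record chart (R : realType) (n : nat) (T : topologicalType) := Chart {
  cdom : set T;
  cmap : T -> 'rV[R]_n;
  cinv : 'rV[R]_n -> T;
  cdom_open : open cdom;
  cimg_open : open (cmap @` cdom);
  cmapK : forall p, cdom p -> cinv (cmap p) = p;
  cmap_continuous : forall p, cdom p -> {for p, continuous cmap};
  cinv_continuous : forall x, (cmap @` cdom) x -> {for x, continuous cinv} }.

Definition cimg (R : realType) (n : nat) (T : topologicalType)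
    (phi : chart R n T) : set 'rV[R]_n :=
  cmap phi @` cdom phi.

Definition transition (R : realType) (n : nat) (T : topologicalType)
    (phi psi : chart R n T) (a : 'I_n) (x : 'rV[R]_n) : R :=
  cmap psi (cinv phi x) 0 a.

Definition smooth_compatible (R : realType) (n : nat) (T : topologicalType)
    (phi psi : chart R n T) : Prop :=
  forall a, smooth_on (cmap phi @` (cdom phi `&` cdom psi))
                      (transition phi psi a).

Record smooth_manifold (R : realType) (n : nat) := SmoothManifold {
  carrier :> topologicalType;
  carrier_hausdorff : hausdorff_space carrier;
  carrier_second_countable : @second_countable carrier;
  atlas : set (chart R n carrier);
  atlas_cover : forall p, exists2 phi, atlas phi & cdom phi p;
  atlas_compatible : forall phi psi, atlas phi -> atlas psi ->
    smooth_compatible phi psi }.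

(** * Local tensor calculus

   Components of tensors in coordinates are functions of the coordinate vector
   [x] and of the indices. Throughout, [g] denotes the components g_ij of a
   metric. *)

Definition pd (R : realType) (n : nat) (i : 'I_n) (u : 'rV[R]_n -> R)
    (x : 'rV[R]_n) : R :=
  'D_(delta_mx 0 i) u x.

Definition df (R : realType) (n : nat) (u : 'rV[R]_n -> R) (x : 'rV[R]_n)
    (i : 'I_n) : R :=
  pd i u x.

(* g^{ij} *)
Definition ginv (R : realType) (n : nat) (g : 'rV[R]_n -> 'I_n -> 'I_n -> R)
    (x : 'rV[R]_n) (i j : 'I_n) : R :=
  invmx (\matrix_(a, b) g x a b) i j.

(* Pointwise index gymnastics; [gi] stands for the values g^{ij} at a point. *)

(* w^p = g^{pq} w_q *)
Definition sharp (R : realType) (n : nat) (gi : 'I_n -> 'I_n -> R)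
    (w : 'I_n -> R) (p : 'I_n) : R :=
  \sum_(q < n) gi p q * w q.

(* T_j^p = g^{pq} T_{jq} *)
Definition up1 (R : realType) (n : nat) (gi T : 'I_n -> 'I_n -> R)
    (j p : 'I_n) : R :=
  \sum_(q < n) gi p q * T j q.

(* T^{pq} = g^{pa} g^{qb} T_{ab} *)
Definition up2 (R : realType) (n : nat) (gi T : 'I_n -> 'I_n -> R)
    (p q : 'I_n) : R :=
  \sum_(a < n) \sum_(b < n) gi p a * gi q b * T a b.

Definition tr (R : realType) (n : nat) (gi T : 'I_n -> 'I_n -> R) : R :=
  \sum_(i < n) \sum_(j < n) gi i j * T i j.

Definition ip1 (R : realType) (n : nat) (gi : 'I_n -> 'I_n -> R)
    (v w : 'I_n -> R) : R :=
  \sum_(p < n) v p * sharp gi w p.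

Definition ip2 (R : realType) (n : nat) (gi A B : 'I_n -> 'I_n -> R) : R :=
  \sum_(p < n) \sum_(q < n) up2 gi A p q * B p q.

(* Levi-Civita connection: [christoffel g x k i j] is Gamma^k_{ij}. *)
Definition christoffel (R : realType) (n : nat)
    (g : 'rV[R]_n -> 'I_n -> 'I_n -> R) (x : 'rV[R]_n) (k i j : 'I_n) : R :=
  2^-1 * \sum_(l < n) ginv g x k l *
    (pd i (fun y => g y j l) x + pd j (fun y => g y i l) x
     - pd l (fun y => g y i j) x).

(* Covariant derivatives of covariant tensors of rank 1, 2, 3. The index of
   differentiation comes first: [nabla2 g T x i j k] is nabla_i T_{jk}. *)
Definition nabla1 (R : realType) (n : nat)
    (g : 'rV[R]_n -> 'I_n -> 'I_n -> R) (w : 'rV[R]_n -> 'I_n -> R)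
    (x : 'rV[R]_n) (i j : 'I_n) : R :=
  pd i (fun y => w y j) x - \sum_(m < n) christoffel g x m i j * w x m.

Definition nabla2 (R : realType) (n : nat)
    (g : 'rV[R]_n -> 'I_n -> 'I_n -> R) (T : 'rV[R]_n -> 'I_n -> 'I_n -> R)
    (x : 'rV[R]_n) (i j k : 'I_n) : R :=
  pd i (fun y => T y j k) x
  - \sum_(m < n) christoffel g x m i j * T x m k
  - \sum_(m < n) christoffel g x m i k * T x j m.

Definition nabla3 (R : realType) (n : nat)
    (g : 'rV[R]_n -> 'I_n -> 'I_n -> R)
    (T : 'rV[R]_n -> 'I_n -> 'I_n -> 'I_n -> R)
    (x : 'rV[R]_n) (i j k l : 'I_n) : R :=
  pd i (fun y => T y j k l) x
  - \sum_(m < n) christoffel g x m i j * T x m k l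
  - \sum_(m < n) christoffel g x m i k * T x j m l
  - \sum_(m < n) christoffel g x m i l * T x j k m.

(* [hess g u x i j] is nabla_i nabla_j u. *)
Definition hess (R : realType) (n : nat) (g : 'rV[R]_n -> 'I_n -> 'I_n -> R)
    (u : 'rV[R]_n -> R) : 'rV[R]_n -> 'I_n -> 'I_n -> R :=
  nabla1 g (df u).

Definition grad (R : realType) (n : nat) (g : 'rV[R]_n -> 'I_n -> 'I_n -> R)
    (u : 'rV[R]_n -> R) (x : 'rV[R]_n) : 'I_n -> R :=
  sharp (ginv g x) (df u x).

Definition grad_norm2 (R : realType) (n : nat)
    (g : 'rV[R]_n -> 'I_n -> 'I_n -> R) (u : 'rV[R]_n -> R)
    (x : 'rV[R]_n) : R :=
  ip1 (ginv g x) (df u x) (df u x).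

Definition laplace0 (R : realType) (n : nat)
    (g : 'rV[R]_n -> 'I_n -> 'I_n -> R) (u : 'rV[R]_n -> R)
    (x : 'rV[R]_n) : R :=
  tr (ginv g x) (hess g u x).

Definition laplace2 (R : realType) (n : nat)
    (g : 'rV[R]_n -> 'I_n -> 'I_n -> R) (T : 'rV[R]_n -> 'I_n -> 'I_n -> R)
    (x : 'rV[R]_n) (j k : 'I_n) : R :=
  tr (ginv g x) (fun p q => nabla3 g (nabla2 g T) x p q j k).

Definition drift_laplace0 (R : realType) (n : nat)
    (g : 'rV[R]_n -> 'I_n -> 'I_n -> R) (f u : 'rV[R]_n -> R)
    (x : 'rV[R]_n) : R :=
  laplace0 g u x - \sum_(p < n) df f x p * grad g u x p.

Definition drift_laplace2 (R : realType) (n : nat)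
    (g : 'rV[R]_n -> 'I_n -> 'I_n -> R) (f : 'rV[R]_n -> R)
    (T : 'rV[R]_n -> 'I_n -> 'I_n -> R) (x : 'rV[R]_n) (j k : 'I_n) : R :=
  laplace2 g T x j k - \sum_(p < n) grad g f x p * nabla2 g T x p j k.

(* [curv g x p j k l] is the coefficient of d_l in
   nabla_p nabla_j d_k - nabla_j nabla_p d_k. With this sign
   Ric_{jk} = g^{pq} R_{pjkq} is positive on round spheres. *)
Definition curv (R : realType) (n : nat) (g : 'rV[R]_n -> 'I_n -> 'I_n -> R)
    (x : 'rV[R]_n) (p j k l : 'I_n) : R :=
  pd p (fun y => christoffel g y l j k) x
  - pd j (fun y => christoffel g y l p k) x
  + \sum_(m < n) (christoffel g x m j k * christoffel g x l p m
                  - christoffel g x m p k * christoffel g x l j m).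

(* R_{pjkq} *)
Definition rm (R : realType) (n : nat) (g : 'rV[R]_n -> 'I_n -> 'I_n -> R)
    (x : 'rV[R]_n) (p j k q : 'I_n) : R :=
  \sum_(l < n) g x q l * curv g x p j k l.

(* R_{pjk}^l = g^{lq} R_{pjkq} *)
Definition rm_up (R : realType) (n : nat) (g : 'rV[R]_n -> 'I_n -> 'I_n -> R)
    (x : 'rV[R]_n) (p j k l : 'I_n) : R :=
  \sum_(q < n) ginv g x l q * rm g x p j k q.

Definition ric (R : realType) (n : nat) (g : 'rV[R]_n -> 'I_n -> 'I_n -> R)
    (x : 'rV[R]_n) (j k : 'I_n) : R :=
  tr (ginv g x) (fun p q => rm g x p j k q).

(* 1 / (N - n), which is 0 for N infinite *)
Definition dim_coef (R : realType) (n : nat) (N : \bar R) : R :=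
  if N is r%:E then (r - n%:R)^-1 else 0.

Definition bakry_emery (R : realType) (n : nat) (N : \bar R)
    (g : 'rV[R]_n -> 'I_n -> 'I_n -> R) (f : 'rV[R]_n -> R)
    (x : 'rV[R]_n) (j k : 'I_n) : R :=
  ric g x j k + hess g f x j k - dim_coef n N * (df f x j * df f x k).

Definition bakry_emery_scal (R : realType) (n : nat) (N : \bar R)
    (g : 'rV[R]_n -> 'I_n -> 'I_n -> R) (f : 'rV[R]_n -> R)
    (x : 'rV[R]_n) : R :=
  tr (ginv g x) (bakry_emery N g f x).

Definition tilde_scal (R : realType) (n : nat) (N : \bar R) (k : R)
    (g : 'rV[R]_n -> 'I_n -> 'I_n -> R) (f : 'rV[R]_n -> R)
    (x : 'rV[R]_n) : R :=
  bakry_emery_scal N g f x + drift_laplace0 g f f x - k * grad_norm2 g f x.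

(** * Time-dependent metrics and functions on a manifold *)

(* A covariant 2-tensor field through its components: [T phi x i j] is the
   (i, j) component in the chart [phi] at the point of coordinates [x]. *)
Definition tensor2 (R : realType) (n : nat) (M : smooth_manifold R n) :=
  chart R n M -> 'rV[R]_n -> 'I_n -> 'I_n -> R.

Definition is_tensor2 (R : realType) (n : nat) (M : smooth_manifold R n)
    (T : tensor2 M) : Prop :=
  forall phi psi : chart R n M, atlas phi -> atlas psi ->
  forall p, cdom phi p -> cdom psi p -> forall i j,
    T phi (cmap phi p) i j =
    \sum_(a < n) \sum_(b < n)
      pd i (transition phi psi a) (cmap phi p) *
      pd j (transition phi psi b) (cmap phi p) * T psi (cmap psi p) a b.

Definition is_riemannian (R : realType) (n : nat) (M : smooth_manifold R n)
    (g : tensor2 M) : Prop :=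
  is_tensor2 g /\
  forall phi : chart R n M, atlas phi -> forall x, cimg phi x ->
    (forall i j, g phi x i j = g phi x j i) /\
    (forall v : 'rV[R]_n, v != 0 ->
       0 < \sum_(i < n) \sum_(j < n) g phi x i j * v 0 i * v 0 j).

(* The families are smooth jointly in time and space. *)
Definition smooth_metric_family (R : realType) (n : nat)
    (M : smooth_manifold R n) (I : set R) (g : R -> tensor2 M) : Prop :=
  (forall t, I t -> is_riemannian (g t)) /\
  forall phi : chart R n M, atlas phi -> forall i j,
    smooth_on (I `*` cimg phi : set (R * 'rV[R]_n)%type)
              (fun tx => g tx.1 phi tx.2 i j).

Definition in_chart (R : realType) (n : nat) (M : smooth_manifold R n)
    (u : M -> R) (phi : chart R n M) : 'rV[R]_n -> R :=
  u \o cinv phi.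

Definition smooth_function_family (R : realType) (n : nat)
    (M : smooth_manifold R n) (I : set R) (f : R -> M -> R) : Prop :=
  forall phi : chart R n M, atlas phi ->
    smooth_on (I `*` cimg phi : set (R * 'rV[R]_n)%type)
              (fun tx => in_chart (f tx.1) phi tx.2).

Definition bakry_emery_flow (R : realType) (n : nat) (M : smooth_manifold R n)
    (N : \bar R) (I : set R) (g : R -> tensor2 M) (f : R -> M -> R) : Prop :=
  forall phi : chart R n M, atlas phi ->
  forall t, I t -> forall x, cimg phi x ->
    (forall i j, is_derive t (1 : R) (fun s => g s phi x i j)
       (- 2 * bakry_emery N (g t phi) (in_chart (f t) phi) x i j)) /\
    is_derive t (1 : R) (fun s => in_chart (f s) phi x)
      (drift_laplace0 (g t phi) (in_chart (f t) phi) (in_chart (f t) phi) x).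

(* Main.v *)
Require Import Defs.
From HB Require Import structures.
From mathcomp Require Import all_boot all_order all_algebra.
From mathcomp Require Import all_classical all_reals all_analysis.
From mathcomp Require Import perm ring.

Set Implicit Arguments.
Unset Strict Implicit.
Unset Printing Implicit Defensive.

Import Order.TTheory GRing.Theory Num.Theory.
Import numFieldNormedType.Exports.

Local Open Scope classical_set_scope.
Local Open Scope ring_scope.

(** Both sides of each formula are polynomials in the partial derivatives of
   the components of g and f at a point, so in principle one expands them. What
   makes this feasible is to compute on the bundle of linear frames.

   Fix a chart and let (t, x, e) range over triples of a time, a point and an
   invertible matrix e, whose rows e_a are a frame of the tangent space at x. A
   tensor field T becomes the family of functions T_ab = T(e_a, e_b) of
   (t, x, e). If D_c denotes the horizontal lift of e_c, that is the vector
   field that moves x along e_c and transports e by parallelism, then the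
   components of the covariant derivative of T are just D_c T_ab. Covariant
   differentiation is thereby replaced by derivations of a commutative ring,
   with D_c g_ab = 0, and the geometry sits in the brackets of vector fields:
   with E^c_d the vertical field that replaces e_c by e_d,

     [D_a, D_b] = - R_abc^d E^c_d,   [E^c_d, D_a] = delta^c_a D_d,
     [d/dt, D_a] = - C_ab^c E^b_c,

   where R is the curvature and C the time derivative of the connection. These
   fields are linearly independent over the ring, hence the components of a
   Jacobi identity vanish separately. For D_a, D_b, D_c this gives both Bianchi
   identities ([bianchi_frame]), and for d/dt, D_a, D_b it gives the symmetry of
   C and dR_abc^d/dt = D_a C_bc^d - D_b C_ac^d ([curvature_variation]).
   Differentiating D_c g_ab = 0 in time expresses C through h = dg/dt
   ([dconnE]), and together these yield 2 dRic/dt = V(h) for an explicit linear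
   operator V ([dt_ricci_varRic]).

   Under the flow, h = -2 (Ric + Hess f - c df df) with c = 1 / (N - n), and V
   is computed on the three summands. The value of V(Ric) is minus the
   Lichnerowicz Laplacian of Ric, by the contracted Bianchi identity
   ([varRic_ricci]). The tensor 2 Hess f is the Lie derivative of g along grad
   f, and accordingly V(Hess f) is the Lie derivative of Ric ([varRic_hess]).
   On df df the third derivatives of f cancel up to one commutator, and the
   bracket of the first formula remains ([varRic_grad2]). The same commutations
   give the evolution of Hess f ([dt_hess_flow]) and of |grad f|^2, the latter
   being Bochner's formula ([lap_grad_norm], [dt_grad_norm_flow]). The other
   three formulas are combinations of these and their traces.

   To apply this, the smooth functions on an open set are made into a
   commutative ring in which the directional derivatives are commuting
   derivations; commutation is the theorem of Schwarz ([schwarz]). At the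
   coordinate frame e = 1 frame components are coordinate components, so
   evaluation there returns the formulas of the theorem. *)

(** * Derivations of a commutative ring *)

Definition derivation (B : comPzRingType) (d : B -> B) : Prop :=
  (forall u v, d (u + v) = d u + d v) /\
  (forall u v, d (u * v) = d u * v + u * d v).

Section Derivations.
Variables (B : comPzRingType) (d : B -> B).
Hypothesis hd : derivation d.

Lemma derD u v : d (u + v) = d u + d v. Proof. exact: hd.1. Qed.

Lemma derM u v : d (u * v) = d u * v + u * d v. Proof. exact: hd.2. Qed.

Lemma der0 : d 0 = 0.
Proof. by apply: (addrI (d 0)); rewrite -derD !addr0. Qed.

Lemma der1 : d 1 = 0.
Proof.
have := derM 1 1; rewrite !mulr1 mul1r => h.
by apply: (addrI (d 1)); rewrite addr0 -h.
Qed.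

Lemma derN u : d (- u) = - d u.
Proof. by apply: (addrI (d u)); rewrite -derD !subrr der0. Qed.

Lemma derB u v : d (u - v) = d u - d v.
Proof. by rewrite derD derN. Qed.

Lemma der_sum (T : finType) (F : T -> B) : d (\sum_i F i) = \sum_i d (F i).
Proof. exact: (big_morph d derD der0). Qed.

Lemma der_nat k : d k%:R = 0.
Proof. by elim: k => [|k IH]; rewrite ?der0 // -addn1 natrD derD IH der1 addr0. Qed.

Lemma der_sumM (T : finType) (F G : T -> B) :
  d (\sum_i F i * G i) = \sum_i d (F i) * G i + \sum_i F i * d (G i).
Proof. by rewrite der_sum -big_split; apply: eq_bigr => i _; rewrite derM. Qed.

End Derivations.

Lemma sum_delta (B : pzRingType) (T : finType) (a : T) (F : T -> B) :
  \sum_i (a == i)%:R * F i = F a.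
Proof.
rewrite (bigD1 a) //= eqxx mul1r big1 ?addr0 // => i /negbTE.
by rewrite eq_sym => ->; rewrite mul0r.
Qed.

(** Deduces an equation from a multiple of another one, leaving to [ring] the
   identity that relates them. *)
Lemma lin_comb (B : comPzRingType) (k l r a b : B) :
  l = r -> a = b + k * (l - r) -> a = b.
Proof. by move=> ->; rewrite subrr mulr0 addr0. Qed.

Arguments lin_comb {B} k {l r a b}.

(** Differentiate g gi = 1 and multiply by gi on the left. *)
Lemma der_inverse (B : comPzRingType) (n : nat) (d : B -> B)
    (g gi : 'I_n -> 'I_n -> B) a b : derivation d ->
  (forall i j, \sum_k g i k * gi k j = (i == j)%:R) ->
  (forall i j, \sum_k gi i k * g k j = (i == j)%:R) ->
  d (gi a b) = - \sum_p \sum_q gi a p * d (g p q) * gi q b.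
Proof.
move=> hd gK giK.
have h c : \sum_q d (g c q) * gi q b + \sum_q g c q * d (gi q b) = 0.
  by rewrite -(der_sumM hd) gK (der_nat hd).
rewrite -(sum_delta a (fun q => d (gi q b))).
under eq_bigr => q _ do rewrite -giK mulr_suml.
rewrite exchange_big -sumrN; apply: eq_bigr => c _.
under eq_bigr => q _ do rewrite -mulrA.
under [in RHS]eq_bigr => q _ do rewrite -mulrA.
rewrite -!mulr_sumr -mulrN; congr (_ * _).
by apply: (lin_comb 1 (h c)); ring.
Qed.

(** * Calculus on the frame bundle *)

(** The derivations of the frame bundle and the brackets between them, over an
   arbitrary ring of functions. [fD a] is the horizontal field of e_a,
   [fE c d] is E^c_d and [ft] is the time derivative; [fR a b c d] is R_abc^d
   and [fC a b c] is C_ab^c, the last index being the contravariant one.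
   [fE_ric] says that Ric_ab is the component of a tensor. *)
Record frame_calculus (B : comPzRingType) (n : nat) := FrameCalculus {
  fD : 'I_n -> B -> B;
  fE : 'I_n -> 'I_n -> B -> B;
  ft : B -> B;
  fR : 'I_n -> 'I_n -> 'I_n -> 'I_n -> B;
  fC : 'I_n -> 'I_n -> 'I_n -> B;
  fg : 'I_n -> 'I_n -> B;
  fgi : 'I_n -> 'I_n -> B;
  fhalf : B;
  fD_der : forall a, derivation (fD a);
  fE_der : forall c d, derivation (fE c d);
  ft_der : derivation ft;
  comm_ED : forall c d a u,
    fE c d (fD a u) = fD a (fE c d u) + (a == c)%:R * fD d u;
  comm_DD : forall a b u, fD a (fD b u) - fD b (fD a u) =
    - \sum_c \sum_d fR a b c d * fE c d u;
  comm_tE : forall c d u, ft (fE c d u) = fE c d (ft u);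
  comm_tD : forall a u, ft (fD a u) =
    fD a (ft u) - \sum_b \sum_c fC a b c * fE b c u;
  frame_free : forall w v,
    (forall u, \sum_c \sum_d w c d * fE c d u + \sum_a v a * fD a u = 0) ->
    (forall c d, w c d = 0) /\ (forall a, v a = 0);
  fgC : forall a b, fg a b = fg b a;
  fgiC : forall a b, fgi a b = fgi b a;
  fgK : forall a b, \sum_c fg a c * fgi c b = (a == b)%:R;
  fD_g : forall c a b, fD c (fg a b) = 0;
  fE_g : forall c d a b, fE c d (fg a b) =
    (a == c)%:R * fg d b + (b == c)%:R * fg a d;
  fE_ric : forall c d a b, fE c d (\sum_p fR p a b p) =
    (a == c)%:R * (\sum_p fR p d b p) + (b == c)%:R * (\sum_p fR p a d p);
  fhalfE : fhalf * 2 = 1 }.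

Section Calculus.
Variables (B : comPzRingType) (n : nat) (F : frame_calculus B n).

Local Notation I := 'I_n.
Local Notation D := (fD F).
Local Notation E := (fE F).
Local Notation dt := (ft F).
Local Notation R := (fR F).
Local Notation C := (fC F).
Local Notation g := (fg F).
Local Notation gi := (fgi F).

Let DD a := derD (fD_der F a).
Let DM a := derM (fD_der F a).
Let DN a := derN (fD_der F a).
Let DB a := derB (fD_der F a).

(** The vertical fields generate the action of the linear group on frames, so
   the rank of a tensor is recognized by how they act on its components. *)
Definition is_scalar u := forall c d, E c d u = 0.
Definition is_covec (w : I -> B) := forall c d a, E c d (w a) = (a == c)%:R * w d.
Definition is_tens2 (T : I -> I -> B) := forall c d a b,
  E c d (T a b) = (a == c)%:R * T d b + (b == c)%:R * T a d.

Lemma sum_sum_delta (w : I -> I -> B) (a : I) (X : I -> B) :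
  \sum_c \sum_d w c d * ((a == c)%:R * X d) = \sum_d w a d * X d.
Proof.
under eq_bigr => c _.
  under eq_bigr => d _ do rewrite mulrCA.
  rewrite -mulr_sumr; over.
by rewrite sum_delta.
Qed.

Lemma scalar_covec u : is_scalar u -> is_covec (D^~ u).
Proof. by move=> hu c d a; rewrite comm_ED hu (der0 (fD_der F a)) add0r. Qed.

Lemma covec_tens2 w : is_covec w -> is_tens2 (fun a b => D a (w b)).
Proof.
move=> hw c d a b; rewrite comm_ED hw DM.
by rewrite (der_nat (fD_der F a)) mul0r add0r addrC.
Qed.

Lemma comm_scalar u a b : is_scalar u -> D a (D b u) = D b (D a u).
Proof.
move=> hu; apply/eqP; rewrite -subr_eq0 comm_DD; apply/eqP.
rewrite big1 ?oppr0 // => c _; rewrite big1 // => d _.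
by rewrite hu mulr0.
Qed.

Lemma comm_covec w a b c : is_covec w ->
  D a (D b (w c)) = D b (D a (w c)) - \sum_d R a b c d * w d.
Proof.
move=> hw; have := comm_DD F a b (w c).
under [X in _ = - X]eq_bigr => p _ do under eq_bigr => q _ do rewrite hw.
rewrite sum_sum_delta => h; apply: (lin_comb 1 h); ring.
Qed.

Lemma comm_tens2 T a b c d : is_tens2 T ->
  D a (D b (T c d)) = D b (D a (T c d))
    - \sum_e R a b c e * T e d - \sum_e R a b d e * T c e.
Proof.
move=> hT.
have := comm_DD F a b (T c d).
under [X in _ = - X]eq_bigr => p _ do
  (under eq_bigr => q _ do rewrite hT mulrDr; rewrite big_split /=).
by rewrite big_split /= !sum_sum_delta => h; apply: (lin_comb 1 h); ring.
Qed.

(** One of the three terms of the Jacobi identity: [D_a, [D_b, D_c]], expanded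
   by Leibniz and [E, D]. *)
Lemma bracket_curv_D a b c u :
  D a (D b (D c u)) - D a (D c (D b u)) - D b (D c (D a u)) + D c (D b (D a u))
  = - (\sum_p \sum_q D a (R b c p q) * E p q u) + \sum_q R b c a q * D q u.
Proof.
have -> : D a (D b (D c u)) - D a (D c (D b u)) - D b (D c (D a u))
   + D c (D b (D a u)) =
   D a (D b (D c u) - D c (D b u)) - (D b (D c (D a u)) - D c (D b (D a u))).
  rewrite DB; ring.
rewrite !comm_DD DN (der_sum (fD_der F a)).
under eq_bigr => p _ do rewrite (der_sumM (fD_der F a)).
rewrite big_split /=.
under [X in _ - - X]eq_bigr => p _.
  under eq_bigr => q _ do rewrite comm_ED mulrDr.
  rewrite big_split /=; over.
rewrite big_split /= sum_sum_delta; ring.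
Qed.

(** The Jacobi identity for D_a, D_b, D_c. Its vertical part is the second
   Bianchi identity and its horizontal part the first one. *)
Lemma bianchi_frame a b c :
  (forall p q, D a (R b c p q) + D b (R c a p q) + D c (R a b p q) = 0) /\
  (forall q, R b c a q + R c a b q + R a b c q = 0).
Proof.
have [u|h1 h2] := @frame_free B n F
  (fun p q => - (D a (R b c p q) + D b (R c a p q) + D c (R a b p q)))
  (fun q => R b c a q + R c a b q + R a b c q).
  have h1 := bracket_curv_D a b c u.
  have h2 := bracket_curv_D b c a u.
  have h3 := bracket_curv_D c a b u.
  under eq_bigr => p _ do
   (under eq_bigr => q _ do rewrite mulNr !mulrDl; rewrite sumrN !big_split /=).
  rewrite sumrN !big_split /=.
  under [X in _ + X]eq_bigr => q _ do rewrite !mulrDl.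
  rewrite !big_split /=.
  apply: (lin_comb (-1) h1); apply: (lin_comb (-1) h2); apply: (lin_comb (-1) h3); ring.
split=> [p q|//]; by have /eqP := h1 p q; rewrite oppr_eq0 => /eqP.
Qed.

Lemma bracket_time_D a b u :
  dt (D a (D b u) - D b (D a u)) =
  D a (D b (dt u)) - D b (D a (dt u))
  + \sum_p \sum_q (D b (C a p q) - D a (C b p q)) * E p q u
  - \sum_q (C a b q - C b a q) * D q u.
Proof.
(* Exchanging a' and b' swaps the third and fourth terms, so these cancel in
   the bracket. *)
have hM a' b' : dt (D a' (D b' u)) = D a' (D b' (dt u))
    - (\sum_p \sum_q D a' (C b' p q) * E p q u)
    - (\sum_p \sum_q C b' p q * D a' (E p q u))
    - (\sum_p \sum_q C a' p q * D b' (E p q u))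
    - \sum_q C a' b' q * D q u.
  rewrite comm_tD comm_tD DB (der_sum (fD_der F a')).
  under [X in _ - X - _]eq_bigr => p _ do rewrite (der_sumM (fD_der F a')).
  rewrite big_split /=.
  under [X in _ - _ - X]eq_bigr => p _.
    under eq_bigr => q _ do rewrite comm_ED mulrDr.
    rewrite big_split /=; over.
  rewrite big_split /= sum_sum_delta; ring.
rewrite (derB (ft_der F)) !hM.
have -> : \sum_q (C a b q - C b a q) * D q u =
    \sum_q C a b q * D q u - \sum_q C b a q * D q u.
  by rewrite -sumrB; apply: eq_bigr => q _; rewrite mulrBl.
have -> : \sum_p \sum_q (D b (C a p q) - D a (C b p q)) * E p q u =
    \sum_p \sum_q D b (C a p q) * E p q u
    - \sum_p \sum_q D a (C b p q) * E p q u.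
  rewrite -sumrB; apply: eq_bigr => p _; rewrite -sumrB.
  by apply: eq_bigr => q _; rewrite mulrBl.
ring.
Qed.

(** The Jacobi identity for d/dt, D_a, D_b: the vertical part is the variation
   of the curvature, and the horizontal part is the symmetry of the variation of
   the connection. *)
Lemma curvature_variation a b :
  (forall p q, dt (R a b p q) = D a (C b p q) - D b (C a p q)) /\
  (forall q, C a b q = C b a q).
Proof.
have [u|h1 h2] := @frame_free B n F
  (fun p q => dt (R a b p q) + (D b (C a p q) - D a (C b p q)))
  (fun q => - (C a b q - C b a q)).
  have h := bracket_time_D a b u.
  rewrite !comm_DD (derN (ft_der F)) (der_sum (ft_der F)) in h.
  rewrite (_ : \sum_p dt _ = \sum_p \sum_q dt (R a b p q) * E p q u
      + \sum_p \sum_q R a b p q * E p q (dt u)) in h; last first.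
    rewrite -big_split; apply: eq_bigr => p _; rewrite (der_sumM (ft_der F)).
    by congr (_ + _); apply: eq_bigr => q _; rewrite comm_tE.
  have -> : \sum_q - (C a b q - C b a q) * D q u =
      - \sum_q (C a b q - C b a q) * D q u.
    by rewrite -sumrN; apply: eq_bigr => q _; rewrite mulNr.
  have -> : \sum_p \sum_q (dt (R a b p q) + (D b (C a p q) - D a (C b p q)))
        * E p q u = \sum_p \sum_q dt (R a b p q) * E p q u
      + \sum_p \sum_q (D b (C a p q) - D a (C b p q)) * E p q u.
    rewrite -big_split; apply: eq_bigr => p _; rewrite -big_split.
    by apply: eq_bigr => q _; rewrite mulrDl.
  apply: (lin_comb (-1) h); ring.
split=> [p q|q]; first by apply: (lin_comb 1 (h1 p q)); ring.
by apply: (lin_comb (-1) (h2 q)); ring.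
Qed.

(** Contractions with the inverse metric. Since its frame components are
   killed by every [D], contractions commute with covariant differentiation. *)
Definition mtr (X : I -> I -> B) : B := \sum_p \sum_q gi p q * X p q.
Definition con (v w : I -> B) : B := mtr (fun p q => v p * w q).
Definition riem a b c d := \sum_e g d e * R a b c e.
Definition ricci b c := \sum_p R p b c p.
Definition dconn a b c := \sum_e g c e * C a b e.

Lemma eq_mtr X Y : (forall p q, X p q = Y p q) -> mtr X = mtr Y.
Proof.
by move=> h; apply: eq_bigr => p _; apply: eq_bigr => q _; rewrite h.
Qed.

Lemma eq_con v v' w w' : v =1 v' -> w =1 w' -> con v w = con v' w'.
Proof. by move=> h h'; apply: eq_mtr => p q; rewrite h h'. Qed.

Lemma mtrD X Y : mtr (fun p q => X p q + Y p q) = mtr X + mtr Y.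
Proof.
rewrite -big_split; apply: eq_bigr => p _; rewrite -big_split.
by apply: eq_bigr => q _; rewrite mulrDr.
Qed.

Lemma mtrZ k X : mtr (fun p q => k * X p q) = k * mtr X.
Proof.
rewrite mulr_sumr; apply: eq_bigr => p _; rewrite mulr_sumr.
by apply: eq_bigr => q _; rewrite mulrCA.
Qed.

Lemma mtrN X : mtr (fun p q => - X p q) = - mtr X.
Proof. by rewrite -[RHS]mulN1r -mtrZ; apply: eq_mtr => p q; rewrite mulN1r. Qed.

Lemma mtrB X Y : mtr (fun p q => X p q - Y p q) = mtr X - mtr Y.
Proof. by rewrite mtrD mtrN. Qed.

Lemma mtrC X : mtr (fun p q => X q p) = mtr X.
Proof.
rewrite /mtr exchange_big; apply: eq_bigr => p _; apply: eq_bigr => q _.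
by rewrite fgiC.
Qed.

Lemma mtr_exch X : mtr (fun p q => mtr (fun r s => X p q r s)) =
  mtr (fun r s => mtr (fun p q => X p q r s)).
Proof.
rewrite /mtr.
have e (Y : I -> I -> I -> I -> B) : \sum_p \sum_q gi p q * \sum_r \sum_s gi r s * Y p q r s
   = \sum_(x : I * I) \sum_(y : I * I) gi x.1 x.2 * gi y.1 y.2 * Y x.1 x.2 y.1 y.2.
  rewrite pair_big; apply: eq_bigr => x _; rewrite pair_big mulr_sumr.
  by apply: eq_bigr => y _; rewrite mulrA.
rewrite !e exchange_big; apply: eq_bigr => x _; apply: eq_bigr => y _.
by congr (_ * _); rewrite mulrC.
Qed.

Lemma eq_conl v v' w : v =1 v' -> con v w = con v' w.
Proof. by move=> h; apply: eq_con. Qed.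

Lemma eq_conr v w w' : w =1 w' -> con v w = con v w'.
Proof. by move=> h; apply: eq_con. Qed.

Lemma conC v w : con v w = con w v.
Proof. by rewrite /con -mtrC; apply: eq_mtr => p q; rewrite mulrC. Qed.

Lemma conDl u v w : con (fun p => u p + v p) w = con u w + con v w.
Proof. by rewrite /con -mtrD; apply: eq_mtr => p q; rewrite mulrDl. Qed.

Lemma conZl k v w : con (fun p => k * v p) w = k * con v w.
Proof. by rewrite /con -mtrZ; apply: eq_mtr => p q; rewrite mulrA. Qed.

Lemma conNl v w : con (fun p => - v p) w = - con v w.
Proof. by rewrite /con -mtrN; apply: eq_mtr => p q; rewrite mulNr. Qed.

Lemma conBl u v w : con (fun p => u p - v p) w = con u w - con v w.
Proof. by rewrite conDl conNl. Qed.

Lemma conDr u v w : con w (fun p => u p + v p) = con w u + con w v.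
Proof. by rewrite !(conC w) conDl. Qed.

Lemma conZr k v w : con w (fun p => k * v p) = k * con w v.
Proof. by rewrite !(conC w) conZl. Qed.

Lemma conNr v w : con w (fun p => - v p) = - con w v.
Proof. by rewrite !(conC w) conNl. Qed.

Lemma conBr u v w : con w (fun p => u p - v p) = con w u - con w v.
Proof. by rewrite conDr conNr. Qed.

Lemma con_mtr X w : con (fun a => mtr (fun p q => X a p q)) w =
  mtr (fun p q => con (fun a => X a p q) w).
Proof.
rewrite /con mtr_exch; apply: eq_mtr => a b; rewrite mulrC -mtrZ.
by apply: eq_mtr => p q; rewrite mulrC.
Qed.

Lemma fgiK a b : \sum_c gi a c * g c b = (a == b)%:R.
Proof.
under eq_bigr => c _ do rewrite mulrC fgC fgiC.
by rewrite fgK eq_sym.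
Qed.

(** Lowering an index and contracting it with the inverse metric is a plain
   contraction. *)
Lemma mtr_lower X : mtr (fun p q => \sum_e g q e * X p e) = \sum_p X p p.
Proof.
apply: eq_bigr => p _.
transitivity (\sum_e (p == e)%:R * X p e); last by rewrite sum_delta.
under eq_bigr => q _ do rewrite mulr_sumr.
rewrite exchange_big; apply: eq_bigr => e _; rewrite -fgiK mulr_suml.
by apply: eq_bigr => q _; rewrite mulrA.
Qed.

Lemma con_lower v w : con (fun p => \sum_e g p e * v e) w = \sum_e v e * w e.
Proof.
rewrite conC -(mtr_lower (fun p q => v q * w p)); apply: eq_mtr => p q.
rewrite mulr_sumr; apply: eq_bigr => e _; ring.
Qed.

Lemma der_gi (d : B -> B) a b : derivation d ->
  d (gi a b) = - \sum_p \sum_q gi a p * d (g p q) * gi q b.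
Proof.
by move=> hd; apply: der_inverse => // i j; [exact: fgK|exact: fgiK].
Qed.

Lemma D_gi c a b : D c (gi a b) = 0.
Proof.
rewrite (der_gi _ _ (fD_der F c)) big1 ?oppr0 // => p _; rewrite big1 // => q _.
by rewrite fD_g mulr0 mul0r.
Qed.

Lemma D_mtr c X : D c (mtr X) = mtr (fun p q => D c (X p q)).
Proof.
rewrite (der_sum (fD_der F c)); apply: eq_bigr => p _.
rewrite (der_sum (fD_der F c)); apply: eq_bigr => q _.
by rewrite DM D_gi mul0r add0r.
Qed.

Lemma D_con c v w : D c (con v w) = con (fun p => D c (v p)) w
  + con v (fun p => D c (w p)).
Proof. by rewrite D_mtr -mtrD; apply: eq_mtr => p q; rewrite DM. Qed.

(** The inverse metric depends on time, whence the second term. *)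
Lemma dt_mtr X : dt (mtr X) = mtr (fun p q => dt (X p q))
  - mtr (fun p q => con (fun r => dt (g p r)) (X q)).
Proof.
have hd := ft_der F.
rewrite (der_sum hd).
under eq_bigr => p _ do
  (rewrite (der_sumM hd); under eq_bigr => q _ do rewrite (der_gi _ _ hd)).
rewrite big_split addrC /=; congr (_ + _).
under eq_bigr => p _ do (under eq_bigr => q _ do rewrite mulNr; rewrite sumrN).
rewrite sumrN; congr (- _).
(* Both sides are sums over p, q, r, s of the terms
   gi p q * gi r s * dt (g p r) * X q s. *)
have e (Y : I -> I -> I -> I -> B) :
    \sum_p \sum_q gi p q * \sum_r \sum_s gi r s * Y p q r s
   = \sum_p \sum_q \sum_r \sum_s gi p q * gi r s * Y p q r s.
  apply: eq_bigr => p _; apply: eq_bigr => q _; rewrite mulr_sumr.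
  apply: eq_bigr => r _; rewrite mulr_sumr.
  by apply: eq_bigr => s _; rewrite mulrA.
transitivity (\sum_p \sum_q \sum_r \sum_s gi p q * gi r s * (dt (g p r) * X q s)); last first.
  by rewrite -(e (fun p q r s => dt (g p r) * X q s)).
rewrite exchange_big /=.
transitivity (\sum_q \sum_p \sum_r \sum_s gi p r * dt (g r s) * gi s q * X p q).
  apply: eq_bigr => q _; apply: eq_bigr => p _; rewrite mulr_suml.
  by apply: eq_bigr => r _; rewrite mulr_suml.
transitivity (\sum_q \sum_p \sum_r \sum_s gi r p * gi s q * (dt (g r s) * X p q)).
  apply: eq_bigr => q _; apply: eq_bigr => p _; apply: eq_bigr => r _.
  by apply: eq_bigr => s _; rewrite (fgiC F p r); ring.
rewrite exchange_big /=.
under eq_bigr => p _ do (rewrite exchange_big /=; under eq_bigr => r _ do rewrite exchange_big /=).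
by rewrite exchange_big.
Qed.

Lemma R_antisym a b c d : R b a c d = - R a b c d.
Proof.
have [u|h _] := @frame_free B n F (fun p q => R b a p q + R a b p q) (fun=> 0).
  rewrite [X in _ + X]big1 ?addr0 => [|q _]; last by rewrite mul0r.
  under eq_bigr => p _ do
    (under eq_bigr => q _ do rewrite mulrDl; rewrite big_split).
  rewrite big_split /=.
  have h1 := comm_DD F a b u; have h2 := comm_DD F b a u.
  by apply: (lin_comb 1 h1); apply: (lin_comb 1 h2); ring.
by apply: (lin_comb 1 (h c d)); ring.
Qed.

Lemma riem_antisym12 a b c d : riem b a c d = - riem a b c d.
Proof.
rewrite /riem -sumrN; apply: eq_bigr => e _.
by rewrite R_antisym mulrN.
Qed.

(** The commutator of two derivatives of the metric vanishes. *)
Lemma riem_antisym34 a b c d : riem a b d c = - riem a b c d.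
Proof.
have := @comm_tens2 (fun a b => g a b) a b c d (fE_g F).
rewrite !fD_g !(der0 (fD_der F _)) => h.
rewrite /riem; apply: (lin_comb 1 h).
have -> : \sum_e R a b c e * g e d = \sum_e g d e * R a b c e.
  by apply: eq_bigr => e _; rewrite mulrC fgC.
have -> : \sum_e R a b d e * g c e = \sum_e g c e * R a b d e.
  by apply: eq_bigr => e _; rewrite mulrC.
ring.
Qed.

(** The Bianchi identities with all indices lowered. *)
Lemma bianchi1 a b c d : riem a b c d + riem b c a d + riem c a b d = 0.
Proof.
rewrite /riem -!big_split big1 //= => e _.
by rewrite -!mulrDr; have := (bianchi_frame a b c).2 e => h;
  rewrite (_ : _ + _ = 0) ?mulr0 //; apply: (lin_comb 1 h); ring.
Qed.

Lemma bianchi2 a b c d m :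
  D a (riem b c d m) + D b (riem c a d m) + D c (riem a b d m) = 0.
Proof.
rewrite !(der_sum (fD_der F _)) -!big_split big1 //= => e _.
rewrite !DM !fD_g !mul0r !add0r -!mulrDr.
by rewrite (bianchi_frame a b c).1 mulr0.
Qed.

Lemma half_inj (x y : B) : 2 * x = 2 * y -> x = y.
Proof.
by move=> h; rewrite -[x]mul1r -[y]mul1r -(fhalfE F) -!mulrA h.
Qed.

(** The classical octahedron argument: combine the four first Bianchi
   identities obtained by rotating a, b, c, d. *)
Lemma riem_pair a b c d : riem a b c d = riem c d a b.
Proof.
apply: half_inj.
have h1 := bianchi1 a b c d; have h2 := bianchi1 b c d a.
have h3 := bianchi1 c d a b; have h4 := bianchi1 d a b c.
have [s1 s2] := (riem_antisym12, riem_antisym34).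
rewrite (s1 a c b d) in h1.
rewrite (s2 b c a d) (s2 c d a b) (s1 b d c a) (s2 b d a c) in h2.
rewrite (s1 a d c b) (s2 a d b c) (s2 a c b d) in h3.
rewrite (s1 a d b c) (s2 a b c d) in h4.
apply: (lin_comb 1 h1); apply: (lin_comb 1 h2).
by apply: (lin_comb (-1) h3); apply: (lin_comb (-1) h4); ring.
Qed.

Lemma ricci_mtr b c : ricci b c = mtr (fun p q => riem p b c q).
Proof. by rewrite /riem mtr_lower. Qed.

Lemma riem_flip a b c d : riem b a d c = riem a b c d.
Proof. by rewrite riem_antisym12 riem_antisym34 opprK. Qed.

Lemma ricciC b c : ricci b c = ricci c b.
Proof.
by rewrite !ricci_mtr -[LHS]mtrC; apply: eq_mtr => p q; rewrite riem_pair riem_flip.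
Qed.

Lemma mtr_riem23 b c : mtr (fun p q => riem b p q c) = ricci b c.
Proof. by rewrite ricci_mtr; apply: eq_mtr => p q; rewrite riem_flip. Qed.

Lemma mtr_riem13 b c : mtr (fun p q => riem p b q c) = - ricci b c.
Proof. by rewrite ricci_mtr -mtrN; apply: eq_mtr => p q; rewrite riem_antisym34. Qed.

(** The Ricci identities: the commutator [D_a, D_b] applied to the components
   of a tensor produces one curvature term for each index. *)
Lemma ricci_covec w a b c : is_covec w ->
  D a (D b (w c)) = D b (D a (w c)) - con (riem a b c) w.
Proof. by move=> hw; rewrite (comm_covec _ _ _ hw) con_lower. Qed.

Lemma ricci_tens2 T a b c d : is_tens2 T ->
  D a (D b (T c d)) = D b (D a (T c d))
    - con (riem a b c) (fun e => T e d) - con (riem a b d) (T c).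
Proof. by move=> hT; rewrite (comm_tens2 _ _ _ _ hT) !con_lower. Qed.

Lemma ricci_is_tens2 : is_tens2 ricci.
Proof. by move=> c d a b; rewrite fE_ric. Qed.

Lemma E_gi c d a b :
  E c d (gi a b) = - ((d == b)%:R * gi a c + (d == a)%:R * gi c b).
Proof.
rewrite (der_gi _ _ (fE_der F c d)); congr (- _).
have e p q : gi a p * E c d (g p q) * gi q b =
    (c == p)%:R * (gi a p * (g d q * gi q b))
    + (c == q)%:R * (gi a p * g p d * gi q b).
  by rewrite fE_g (eq_sym c p) (eq_sym c q); ring.
under eq_bigr => p _ do (under eq_bigr => q _ do rewrite e; rewrite big_split /=).
rewrite big_split /=; congr (_ + _).
  under eq_bigr => p _ do (rewrite -mulr_sumr -mulr_sumr fgK).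
  by rewrite (sum_delta c (fun p => gi a p * _)) mulrC.
under eq_bigr => p _ do rewrite (sum_delta c (fun q => gi a p * g p d * gi q b)).
by rewrite -mulr_suml fgiK eq_sym.
Qed.

(** Invariance of traces; it is needed to commute two derivatives of the scalar
   curvature and of the Laplacian of f. *)
Lemma mtr_scalar T : is_tens2 T -> is_scalar (mtr T).
Proof.
move=> hT c d; have hd := fE_der F c d.
rewrite /mtr (der_sum hd).
under eq_bigr => p _ do rewrite (der_sumM hd).
rewrite big_split /=.
under eq_bigr => p _ do under eq_bigr => q _ do rewrite E_gi.
under [X in _ + X]eq_bigr => p _ do under eq_bigr => q _ do rewrite hT.
have -> : \sum_p \sum_q - ((d == q)%:R * gi p c + (d == p)%:R * gi c q) * T p q
    = - (\sum_p gi p c * T p d + \sum_q gi c q * T d q).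
  rewrite -(sum_delta d (fun p => \sum_q gi c q * T p q)) -big_split -sumrN.
  apply: eq_bigr => p _; rewrite -(sum_delta d (fun q => gi p c * T p q)).
  rewrite mulr_sumr -big_split -sumrN; apply: eq_bigr => q _ /=; ring.
have -> : \sum_p \sum_q gi p q * ((p == c)%:R * T d q + (q == c)%:R * T p d)
    = \sum_q gi c q * T d q + \sum_p gi p c * T p d.
  rewrite -(sum_delta c (fun p => \sum_q gi p q * T d q)) -big_split.
  apply: eq_bigr => p _; rewrite -(sum_delta c (fun q => gi p q * T p d)).
  rewrite mulr_sumr -big_split; apply: eq_bigr => q _ /=.
  rewrite (eq_sym c p) (eq_sym c q); ring.
ring.
Qed.

(** The second Bianchi identity contracted once, which gives the divergence of
   the curvature. *)
Lemma bianchi2_once b c d :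
  mtr (fun a m => D a (riem b c d m)) = D b (ricci c d) - D c (ricci b d).
Proof.
have -> : D b (ricci c d) = - mtr (fun a m => D b (riem c a d m)).
  rewrite ricci_mtr D_mtr -mtrN; apply: eq_mtr => p q.
  by rewrite riem_antisym12 DN.
rewrite ricci_mtr D_mtr -mtrN -mtrB; apply: eq_mtr => a m.
by apply: (lin_comb 1 (bianchi2 a b c d m)); ring.
Qed.

Definition divT (T : I -> I -> B) k := mtr (fun p q => D p (T k q)).

Lemma bianchi2_twice b : 2 * divT ricci b = D b (mtr ricci).
Proof.
have h : mtr (fun c d => mtr (fun a m => D a (riem b c d m))) =
    mtr (fun c d => D b (ricci c d)) - divT ricci b.
  by rewrite -mtrB; apply: eq_mtr => c d; rewrite bianchi2_once.
have e : mtr (fun c d => mtr (fun a m => D a (riem b c d m))) = divT ricci b.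
  by rewrite mtr_exch; apply: eq_mtr => a m; rewrite -D_mtr mtr_riem23.
by rewrite D_mtr; apply: (lin_comb 1 h); rewrite e; ring.
Qed.

(** The tensor R_pjkq T^pq. *)
Definition riemQ (T : I -> I -> B) j k := mtr (fun p a => con (riem p j k) (T a)).
Definition inner (A T : I -> I -> B) := mtr (fun p q => con (A p) (T q)).
Definition lap (T : I -> I -> B) j k := mtr (fun p q => D p (D q (T j k))).
Definition symm (T : I -> I -> B) := forall a b, T a b = T b a.
(** Twice the linearization of the Ricci tensor at the metric, in the direction
   T: see [dt_ricci_varRic]. *)
Definition varRic (T : I -> I -> B) j k :=
  mtr (fun p q => D p (D j (T k q))) + mtr (fun p q => D p (D k (T j q)))
  - lap T j k - D j (D k (mtr T)).

Lemma riemQC T j k : symm T -> riemQ T k j = riemQ T j k.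
Proof.
move=> hT; transitivity (mtr (fun p a => mtr (fun l b => riem l j k p * T a b))).
  apply: eq_mtr => p a; apply: eq_mtr => l b; congr (_ * _).
  by rewrite riem_pair riem_flip.
rewrite mtr_exch; apply: eq_mtr => l b; apply: eq_mtr => p a.
by rewrite hT.
Qed.

(** Commuting the divergence past a derivative produces the curvature terms of
   the Lichnerowicz Laplacian. *)
Lemma mtr_DD T j k : is_tens2 T -> symm T ->
  mtr (fun p q => D p (D j (T k q))) =
  D j (divT T k) - riemQ T j k + con (ricci j) (T k).
Proof.
move=> hT sT.
under eq_mtr => p q do rewrite (ricci_tens2 _ _ _ _ hT).
rewrite 2!mtrB -D_mtr -con_mtr; congr (_ - _ + _).
  by apply: eq_mtr => p q; apply: eq_conr => e; rewrite sT.
by rewrite -conNl; apply: eq_conl => e; rewrite mtr_riem13 opprK.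
Qed.

(** Time derivative of D_c g_ab = 0. *)
Lemma dconn_sum c a b : D c (dt (g a b)) = dconn c a b + dconn c b a.
Proof.
have := comm_tD F c (g a b); rewrite fD_g (der0 (ft_der F)).
have -> : \sum_p \sum_q C c p q * E p q (g a b) = dconn c a b + dconn c b a.
  transitivity (\sum_p \sum_q (C c p q * ((a == p)%:R * g q b)
      + C c p q * ((b == p)%:R * g a q))).
    by apply: eq_bigr => p _; apply: eq_bigr => q _; rewrite fE_g mulrDr.
  under eq_bigr => p _ do rewrite big_split /=.
  rewrite big_split /= !sum_sum_delta /dconn; congr (_ + _).
    by apply: eq_bigr => q _; rewrite mulrC fgC.
  by apply: eq_bigr => q _; rewrite mulrC.
by move=> h; apply: (lin_comb (-1) h); ring.
Qed.

Lemma dconnC a b c : dconn a b c = dconn b a c.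
Proof. by apply: eq_bigr => e _; rewrite (curvature_variation a b).2. Qed.

(** Koszul's formula: a tensor that is symmetric in its first two indices is
   determined by the sums in [dconn_sum]. *)
Lemma dconnE a b c : 2 * dconn a b c =
  D a (dt (g b c)) + D b (dt (g a c)) - D c (dt (g a b)).
Proof.
rewrite !dconn_sum (dconnC b a c) (dconnC c a b) (dconnC c b a); ring.
Qed.

Lemma dt_ricci j k : dt (ricci j k) =
  mtr (fun p q => D p (dconn j k q)) - D j (mtr (fun p q => dconn p k q)).
Proof.
have -> : mtr (fun p q => dconn p k q) = \sum_p C p k p by rewrite mtr_lower.
rewrite (der_sum (ft_der F)) (der_sum (fD_der F j)).
have -> : mtr (fun p q => D p (dconn j k q)) = \sum_p D p (C j k p).
  rewrite -(mtr_lower (fun p e => D p (C j k e))); apply: eq_mtr => p q.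
  rewrite (der_sum (fD_der F p)); apply: eq_bigr => e _.
  by rewrite DM fD_g mul0r add0r.
by rewrite -sumrB; apply: eq_bigr => p _; rewrite (curvature_variation p j).1.
Qed.

Lemma dt_ricci_varRic j k : 2 * dt (ricci j k) = varRic (fun a b => dt (g a b)) j k.
Proof.
rewrite dt_ricci mulrBr -mtrZ.
have D2 a u : D a (2 * u) = 2 * D a u.
  by rewrite DM (der_nat (fD_der F a)) mul0r add0r.
under eq_mtr => p q do rewrite -D2 dconnE DB DD.
rewrite mtrB mtrD -D2 -mtrZ.
under [X in _ - D j X]eq_mtr => p q do rewrite dconnE (fgC F p q).
rewrite mtrB mtrD -(mtrC (fun p q => D p (dt (g k q)))).
rewrite (_ : mtr (fun p q => D q _) = mtr (fun p q => D q (dt (g p k)))); last first.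
  by apply: eq_mtr => p q; rewrite (fgC F k p).
rewrite /varRic /lap -D_mtr.
rewrite (_ : mtr (fun p q => dt (g q p)) = mtr (fun p q => dt (g p q))); last first.
  by rewrite mtrC.
by congr (_ - D j _); ring.
Qed.

Lemma varRic_lin (T1 T2 T3 : I -> I -> B) (x y z : B) j k :
  (forall a, D a x = 0) -> (forall a, D a y = 0) -> (forall a, D a z = 0) ->
  varRic (fun a b => x * T1 a b + y * T2 a b + z * T3 a b) j k =
  x * varRic T1 j k + y * varRic T2 j k + z * varRic T3 j k.
Proof.
move=> hx hy hz.
have l a (u v w : B) : D a (x * u + y * v + z * w) =
    x * D a u + y * D a v + z * D a w.
  by rewrite !DD !DM hx hy hz !mul0r !add0r.
have lt (X Y Z : I -> I -> B) :
    mtr (fun p q => x * X p q + y * Y p q + z * Z p q) =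
    x * mtr X + y * mtr Y + z * mtr Z by rewrite !mtrD !mtrZ.
rewrite /varRic /lap !lt !l.
under eq_mtr => p q do rewrite !l.
under [X in _ + X - _ - _]eq_mtr => p q do rewrite !l.
under [X in _ + _ - X - _]eq_mtr => p q do rewrite !l.
rewrite !lt; ring.
Qed.

(** The contracted Bianchi identity makes the second derivatives of the scalar
   curvature cancel. *)
Lemma varRic_ricci j k : varRic ricci j k =
  - lap ricci j k - 2 * riemQ ricci j k + 2 * con (ricci j) (ricci k).
Proof.
(* Doubling lets [bianchi2_twice] apply without dividing by 2. *)
apply: half_inj; rewrite /varRic !(mtr_DD _ _ ricci_is_tens2 ricciC) (riemQC _ _ ricciC).
have D2 a u : D a (2 * u) = 2 * D a u.
  by rewrite DM (der_nat (fD_der F a)) mul0r add0r.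
have h a b : 2 * D a (divT ricci b) = D a (D b (mtr ricci)).
  by rewrite -D2 bianchi2_twice.
rewrite (conC (ricci k)).
apply: (lin_comb 1 (h j k)); apply: (lin_comb 1 (h k j)).
rewrite (comm_scalar k j (mtr_scalar ricci_is_tens2)); ring.
Qed.

Section Potential.
Variables (f : B).
Hypothesis hf : is_scalar f.

Let v a := D a f.
Let H a b := D a (D b f).

Let vcov : is_covec v := scalar_covec hf.

Let Htens : is_tens2 H := covec_tens2 vcov.

Lemma hessC : symm H.
Proof. by move=> a b; apply: comm_scalar. Qed.

Lemma D_hess_comm a b c : D a (H b c) = D b (H a c) - con (riem a b c) v.
Proof. exact: ricci_covec. Qed.

Lemma divT_hess k : divT H k = D k (mtr H) + con (ricci k) v.
Proof.
have -> : con (ricci k) v = mtr (fun p q => con (riem k p q) v).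
  by rewrite -con_mtr; apply: eq_conl => l; rewrite mtr_riem23.
rewrite D_mtr -mtrD; apply: eq_mtr => p q.
by rewrite (D_hess_comm k p q) subrK.
Qed.

(** By the Ricci identity, up to curvature the three terms are the same third
   derivative of f; the first Bianchi identity merges the two curvature terms. *)
Lemma koszul_hess j k q : D j (H k q) + D k (H j q) - D q (H j k) =
  D j (H k q) - con (riem k q j) v.
Proof.
rewrite (D_hess_comm k j q) (D_hess_comm q j k) (hessC q k).
have h : con (riem k j q) v - con (riem q j k) v - con (riem k q j) v = 0.
  rewrite -!conBl -[RHS](mul0r (con v v)) -conZl; apply: eq_conl => l.
  rewrite mul0r (riem_antisym12 j k).
  by apply: (lin_comb (-1) (bianchi1 j k q l)); ring.
by apply: (lin_comb (-1) h); ring.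
Qed.

(** Hess f is half the Lie derivative of g along grad f, and the Ricci tensor is
   natural, so the result is the Lie derivative of Ric along grad f. In the
   computation, the divergence of the curvature that comes from [koszul_hess]
   turns into derivatives of Ric by [bianchi2_once]. *)
Lemma varRic_hess j k : varRic H j k = con (ricci j) (H k) + con (ricci k) (H j)
  + con (fun l => D l (ricci j k)) v.
Proof.
have hV : varRic H j k = mtr (fun p q => D p (D j (H k q)))
    - mtr (fun p q => D p (con (riem k q j) v)) - D j (D k (mtr H)).
  rewrite /varRic -mtrD -mtrB; congr (_ - _); rewrite -mtrB; apply: eq_mtr => p q.
  by rewrite -DD -DB koszul_hess DB.
rewrite hV (mtr_DD _ _ Htens hessC) divT_hess DD D_con.
under [X in _ - X - _]eq_mtr => p q do rewrite D_con.
rewrite mtrD -con_mtr.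
have -> : mtr (fun p q => con (riem k q j) (fun l => D p (v l))) = - riemQ H j k.
  rewrite -(riemQC _ _ hessC) -mtrN -mtrC; apply: eq_mtr => p q.
  by rewrite -conNl; apply: eq_conl => l; rewrite riem_antisym12.
have -> : con (fun l => mtr (fun p q => D p (riem k q j l))) v =
    con (fun l => D j (ricci k l)) v - con (fun l => D l (ricci j k)) v.
  rewrite -conBl; apply: eq_conl => l; rewrite (ricciC k l) -bianchi2_once.
  by apply: eq_mtr => p q; rewrite riem_pair.
ring.
Qed.

(** The tensor R_pjk^l f_l f^p. *)
Definition riemdf j k := con (fun p => con (riem p j k) v) v.

Let W a b := v a * v b.

Let N := con v v.

Lemma D_grad_norm k : D k N = 2 * con (H k) v.
Proof. by rewrite D_con (conC v) -/(con (H k) v); ring. Qed.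

Lemma D2_grad_norm j k : D j (D k N) =
  2 * con (fun l => D j (H k l)) v + 2 * con (H k) (H j).
Proof. by rewrite D_grad_norm DM (der_nat (fD_der F j)) D_con; ring. Qed.

Lemma con_D_hess j k : con (fun p => D j (H k p)) v =
  con (fun p => D p (H j k)) v + riemdf j k.
Proof.
rewrite -conDl; apply: eq_conl => p.
rewrite (hessC k p) (D_hess_comm j p) (hessC j k).
rewrite (_ : con (riem j p k) v = - con (riem p j k) v) ?opprK //.
by rewrite -conNl; apply: eq_conl => l; rewrite riem_antisym12.
Qed.

Lemma lap_grad2 j k : lap W j k =
  v k * divT H j + v j * divT H k + 2 * con (H j) (H k).
Proof.
rewrite (_ : 2 * _ = con (H j) (H k) + con (H k) (H j)); last first.
  by rewrite (conC (H k)); ring.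
rewrite -!(mtrZ (v _)) -!mtrD; apply: eq_mtr => p q.
by rewrite /W !(DM, DD) -!/(H _ _) -!/(v _) !(hessC _ j) !(hessC _ k); ring.
Qed.

(** Every third derivative of f is contracted with df; they cancel up to one
   commutator, which gives the curvature term. *)
Lemma varRic_grad2 j k : varRic W j k =
  2 * (mtr H * H j k - con (H j) (H k) - riemdf j k).
Proof.
have e1 a b : mtr (fun p q => D p (D a (W b q))) = con (fun p => D p (H a b)) v
    + H a b * mtr H + con (H b) (H a) + v b * divT H a.
  rewrite -mtrZ -(mtrZ (v b)) -!mtrD; apply: eq_mtr => p q.
  rewrite /W !(DM, DD) -!/(H _ _) -!/(v _) (hessC p b); ring.
rewrite /varRic !e1 lap_grad2 -[mtr W]/N D2_grad_norm con_D_hess.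
rewrite (hessC k j) (conC (H k)); ring.
Qed.

(** The Laplacian of a Hessian against the Hessian of the Laplacian, read off
   from [varRic_hess] by commuting derivatives in the definition of [varRic]. *)
Lemma lap_hess j k : lap H j k = D j (D k (mtr H))
  + con (fun l => D j (ricci k l)) v + con (fun l => D k (ricci j l)) v
  - con (fun l => D l (ricci j k)) v
  + con (ricci k) (H j) + con (ricci j) (H k) - 2 * riemQ H j k.
Proof.
have h := varRic_hess j k.
rewrite /varRic !(mtr_DD _ _ Htens hessC) !divT_hess !DD !D_con in h.
rewrite (comm_scalar k j (mtr_scalar Htens)) (riemQC j k hessC) in h.
rewrite -[con (ricci k) (fun p => D j (v p))]/(con (ricci k) (H j)) in h.
rewrite -[con (ricci j) (fun p => D k (v p))]/(con (ricci j) (H k)) in h.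
by apply: (lin_comb (-1) h); ring.
Qed.

Lemma dt_hess j k : dt (H j k) = D j (D k (dt f)) - con (dconn j k) v.
Proof.
rewrite /H comm_tD.
have -> : dt (D k f) = D k (dt f).
  rewrite comm_tD big1 ?subr0 // => p _; rewrite big1 // => q _.
  by rewrite hf mulr0.
congr (_ - _); rewrite con_lower.
under eq_bigr => p _ do under eq_bigr => q _ do rewrite (vcov p q k).
by rewrite sum_sum_delta.
Qed.

Lemma dt_grad k : dt (v k) = D k (dt f).
Proof.
rewrite /v comm_tD big1 ?subr0 // => p _; rewrite big1 // => q _.
by rewrite hf mulr0.
Qed.

Definition bakry (c : B) a b := ricci a b + H a b - c * (v a * v b).

Section Flow.
Variable c : B.
Hypothesis Dc : forall a, D a c = 0.
Hypothesis dtc : dt c = 0.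
Let X := bakry c.
Hypothesis flow_g : forall a b, dt (g a b) = -2 * X a b.
Hypothesis flow_f : dt f = mtr H - N.

Lemma dt_ric_flow j k : dt (ricci j k) =
  lap ricci j k + 2 * riemQ ricci j k - 2 * con (ricci j) (ricci k)
  - con (fun m => D m (ricci j k)) v - con (ricci j) (H k) - con (ricci k) (H j)
  + 2 * c * (mtr H * H j k - con (H j) (H k) - riemdf j k).
Proof.
apply: half_inj; rewrite dt_ricci_varRic.
have eqV (T T' : I -> I -> B) : T =2 T' -> varRic T j k = varRic T' j k.
  move=> h; rewrite /varRic /lap; congr (_ + _ - _ - _).
  - by apply: eq_mtr => p q; rewrite h.
  - by apply: eq_mtr => p q; rewrite h.
  - by apply: eq_mtr => p q; rewrite h.
  - by congr (D j (D k _)); apply: eq_mtr.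
rewrite (eqV _ (fun a b => -2 * ricci a b + -2 * H a b + 2 * c * W a b)); last first.
  by move=> a b; rewrite flow_g /X /bakry /W; ring.
have D2 a : D a (-2) = 0 by rewrite DN (der_nat (fD_der F a)) oppr0.
rewrite varRic_lin //; last first.
  by move=> a; rewrite DM Dc (der_nat (fD_der F a)) mul0r mulr0 addr0.
rewrite varRic_ricci varRic_hess varRic_grad2; ring.
Qed.

(** The Hessian changes with the connection; this is the corresponding term
   C_jk^m f_m. *)
Lemma con_dconn_flow j k : con (dconn j k) v =
  - (con (fun l => D j (ricci k l)) v + con (fun l => D k (ricci j l)) v
     - con (fun l => D l (ricci j k)) v
     + con (fun l => D j (H k l)) v + riemdf j k - 2 * c * H j k * N).
Proof.
apply: half_inj; rewrite -conZl.
have e q : 2 * dconn j k q = -2 * (D j (ricci k q) + D k (ricci j q) - D q (ricci j k)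
     + D j (H k q) - con (riem k q j) v - 2 * c * H j k * v q).
  have D2 a u : D a (-2 * u) = -2 * D a u.
    by rewrite DM DN (der_nat (fD_der F a)) oppr0 mul0r add0r.
  have Dcw a u : D a (c * u) = c * D a u by rewrite DM Dc mul0r add0r.
  rewrite dconnE !flow_g !D2 /X /bakry !DB !DD !Dcw !DM -!/(H _ _) -!/(v _).
  rewrite (hessC q j) (hessC q k) (hessC k j).
  by apply: (lin_comb (-2) (koszul_hess j k q)); ring.
rewrite (eq_conl _ e) conZl.
rewrite !conDl !conNl !conZl.
have -> : con (fun q => con (riem k q j) v) v = - riemdf j k.
  transitivity (mtr (fun p q => mtr (fun r s => - (riem r j k p * v q * v s)))).
    apply: eq_mtr => p q; rewrite mulrC -mtrZ; apply: eq_mtr => r s.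
    rewrite riem_pair riem_antisym12; ring.
  rewrite mtr_exch -mtrN; apply: eq_mtr => r s; rewrite mtrN; congr (- _).
  by rewrite mulrC -mtrZ; apply: eq_mtr => p q; ring.
rewrite -/N; ring.
Qed.

(** The derivatives of Ric contributed by the connection cancel those of
   [lap_hess], and the third derivatives of f contributed by the connection and
   by |grad f|^2 combine into the derivative of Hess f along grad f. *)
Lemma dt_hess_flow j k : dt (H j k) =
  lap H j k + 2 * riemQ H j k - con (ricci j) (H k) - con (ricci k) (H j)
  - con (fun m => D m (H j k)) v - 2 * con (H j) (H k) - 2 * c * H j k * N.
Proof.
rewrite dt_hess flow_f !DB D2_grad_norm con_dconn_flow lap_hess.
rewrite con_D_hess (conC (H k)); ring.
Qed.

Lemma dt_grad_flow k : dt (v k) = D k (mtr H) - 2 * con (H k) v.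
Proof. by rewrite dt_grad flow_f DB D_grad_norm. Qed.

Lemma riemQ_lin (T1 T2 T3 : I -> I -> B) z j k :
  riemQ (fun a b => T1 a b + T2 a b - z * T3 a b) j k =
  riemQ T1 j k + riemQ T2 j k - z * riemQ T3 j k.
Proof.
rewrite -mtrZ -mtrD -mtrB; apply: eq_mtr => p q.
by rewrite conBr conDr conZr.
Qed.

Lemma lap_bakry j k : lap X j k = lap ricci j k + lap H j k - c * lap W j k.
Proof.
rewrite /lap -mtrZ -mtrD -mtrB; apply: eq_mtr => p q.
have Dcw a u : D a (c * u) = c * D a u by rewrite DM Dc mul0r add0r.
by rewrite /X /bakry -/(W j k) !(DD, DN) !Dcw.
Qed.

Lemma riemQ_grad2 j k : riemQ W j k = riemdf j k.
Proof.
apply: eq_mtr => p a; rewrite -[X in con _ X]/(fun b => v a * v b).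
by rewrite conZr mulrC.
Qed.

Lemma con_bakry j w : con (X j) w =
  con (ricci j) w + con (H j) w - c * v j * con v w.
Proof.
rewrite -conZl -conDl -conBl; apply: eq_conl => l.
rewrite /X /bakry; ring.
Qed.

Lemma D_bakry m j k : D m (X j k) =
  D m (ricci j k) + D m (H j k) - c * (H m j * v k + v j * H m k).
Proof. by rewrite /X /bakry DB DD DM Dc DM -!/(H _ _); ring. Qed.

Lemma con_D_bakry j k : con (fun m => D m (X j k)) v =
  con (fun m => D m (ricci j k)) v + con (fun m => D m (H j k)) v
  - c * (v k * con (H j) v + v j * con (H k) v).
Proof.
rewrite mulrDr !mulrA -!conZl opprD !addrA -!conDl -!conBl.
apply: eq_conl => m; rewrite D_bakry (hessC m j) (hessC m k); ring.
Qed.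

Lemma dt_bakry_flow j k : dt (X j k) =
  lap X j k + 2 * riemQ X j k - 2 * con (X j) (X k)
  - con (fun m => D m (X j k)) v
  - c * (con (X j) v * v k + con (X k) v * v j - 2 * (mtr H - N) * H j k).
Proof.
have dtd := ft_der F.
have -> : dt (X j k) = dt (ricci j k) + dt (H j k)
    - c * (dt (v j) * v k + v j * dt (v k)).
  by rewrite /X /bakry (derB dtd) (derD dtd) !(derM dtd) dtc; ring.
have -> : riemQ X j k = riemQ ricci j k + riemQ H j k - c * riemdf j k.
  by rewrite -riemQ_grad2 -riemQ_lin.
rewrite dt_ric_flow dt_hess_flow !dt_grad_flow lap_bakry lap_grad2 !divT_hess.
rewrite con_D_bakry !con_bakry !(conC _ (X k)) !con_bakry -/N.
rewrite (conC v (ricci j)) (conC v (H j)) (conC (ricci k) (ricci j)).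
rewrite (conC (H k) (ricci j)) (conC (H k) (H j)).
ring.
Qed.

Let lap0 u := mtr (fun p q => D p (D q u)).

Lemma innerC (S T : I -> I -> B) : inner S T = inner T S.
Proof.
rewrite -[RHS](mtrC (fun p q => con (T p) (S q))).
by apply: eq_mtr => p q; rewrite conC.
Qed.

Lemma mtr_lap T : mtr (lap T) = lap0 (mtr T).
Proof.
rewrite /lap mtr_exch; apply: eq_mtr => p q.
by rewrite !D_mtr.
Qed.

Lemma mtr_riemQ T : mtr (riemQ T) = inner ricci T.
Proof.
rewrite /riemQ mtr_exch; apply: eq_mtr => p a; rewrite -con_mtr.
by apply: eq_conl => l; rewrite mtr_riem23.
Qed.

Lemma mtr_con_D T : mtr (fun j k => con (fun m => D m (T j k)) v) =
  con (fun m => D m (mtr T)) v.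
Proof. by rewrite -con_mtr; apply: eq_conl => m; rewrite D_mtr. Qed.

Definition quad (T : I -> I -> B) := con (fun j => con (T j) v) v.

Lemma inner_bakry T : inner X T = inner ricci T + inner H T - c * con (fun q => con (T q) v) v.
Proof.
rewrite conC -mtrZ -mtrD -mtrB; apply: eq_mtr => p q.
rewrite con_bakry (conC v); ring.
Qed.

Lemma dt_mtr_flow T : dt (mtr T) = mtr (fun j k => dt (T j k)) + 2 * inner X T.
Proof.
rewrite dt_mtr; congr (_ + _); rewrite -mtrZ -mtrN; apply: eq_mtr => p q.
rewrite -conZl -conNl; apply: eq_conl => r; rewrite flow_g; ring.
Qed.

Lemma dt_bakry_trace : dt (mtr X) = lap0 (mtr X) + 2 * inner X X - 2 * inner X H
  - con (fun p => D p (mtr X)) v + 2 * c * mtr H * (mtr H - N).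
Proof.
rewrite dt_mtr_flow.
have h := inner_bakry X; have hX := dt_bakry_flow.
clearbody X.
under eq_mtr => j k do rewrite hX.
rewrite !(mtrD, mtrN, mtrZ) mtr_lap mtr_riemQ mtr_con_D -/(inner X X) -/(quad X).
rewrite -[mtr (fun p q => con (X q) v * v p)]/(mtr (fun p q =>
  (fun k j => con (X j) v * v k) p q)) (mtrC (fun k j => con (X k) v * v j)).
rewrite -![mtr (fun p q => con (X p) v * v q)]/(quad X).
rewrite -/(quad X) in h.
by apply: (lin_comb (-2) h); rewrite (innerC H X); ring.
Qed.

Lemma dt_lap_flow : dt (mtr H) = lap0 (mtr H) - con (fun p => D p (mtr H)) v
  - 2 * inner H H - 2 * c * mtr H * N + 2 * inner X H.
Proof.
(* Stated for a variable T so that the linearity of the trace does not unfold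
   the Hessian. *)
have gen T : (forall j k, dt (T j k) = lap T j k + 2 * riemQ T j k
      - con (ricci j) (T k) - con (ricci k) (T j)
      - con (fun m => D m (T j k)) v - 2 * con (T j) (T k)
      - 2 * c * N * T j k) ->
    dt (mtr T) = lap0 (mtr T) - con (fun p => D p (mtr T)) v
      - 2 * inner T T - 2 * c * N * mtr T + 2 * inner X T.
  move=> hT; rewrite dt_mtr_flow; congr (_ + _).
  under eq_mtr => j k do rewrite hT.
  rewrite !(mtrD, mtrN, mtrZ) mtr_lap mtr_riemQ mtr_con_D -/(inner T T) -/(inner ricci T).
  rewrite (mtrC (fun q p => con (ricci q) (T p))) -/(inner ricci T); ring.
by rewrite gen => [|j k]; [|rewrite dt_hess_flow]; ring.
Qed.

Lemma quad_bakry : quad X = quad ricci + quad H - c * N ^+ 2.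
Proof.
rewrite expr2 mulrA -conZl -conDl -conBl; apply: eq_conl => j.
rewrite con_bakry -/N; ring.
Qed.

Lemma con_D_grad_norm : con (fun p => D p N) v = 2 * quad H.
Proof. by rewrite -conZl; apply: eq_conl => p; rewrite D_grad_norm. Qed.

(** Bochner's formula. *)
Lemma lap_grad_norm : lap0 N =
  2 * con (fun p => D p (mtr H)) v + 2 * quad ricci + 2 * inner H H.
Proof.
have -> : 2 * con (fun p => D p (mtr H)) v + 2 * quad ricci =
    2 * con (divT H) v.
  rewrite -mulrDr -conDl; congr (_ * _); apply: eq_conl => l.
  by rewrite divT_hess.
rewrite con_mtr -!mtrZ -mtrD; apply: eq_mtr => p q.
rewrite D2_grad_norm (conC (H q)); congr (_ * _ + _).
by apply: eq_conl => l; rewrite hessC.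
Qed.

Lemma dt_grad_norm_flow :
  dt N = lap0 N - con (fun p => D p N) v - 2 * inner H H - 2 * c * N ^+ 2.
Proof.
have e1 : dt N = 2 * con (fun p => D p (mtr H)) v
    - 2 * con (fun p => D p N) v + 2 * quad X.
  rewrite [dt N]dt_mtr_flow; congr (_ + _); last first.
    congr (_ * _); apply: eq_mtr => p q.
    by rewrite -[con (X p) _]/(con (X p) (fun r => v q * v r)) conZr mulrC.
  transitivity (con (fun p => dt (v p)) v + con v (fun p => dt (v p))).
    by rewrite -mtrD; apply: eq_mtr => p q; rewrite (derM (ft_der F)).
  rewrite (conC v) (eq_conl _ dt_grad).
  have e p : D p (dt f) = D p (mtr H) - D p N by rewrite flow_f DB.
  rewrite (eq_conl _ e) conBl; ring.
rewrite e1 quad_bakry con_D_grad_norm lap_grad_norm; ring.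
Qed.

Lemma dt_tilde (k : B) : (forall a, D a k = 0) -> dt k = 0 ->
  let S := mtr X + (mtr H - N) - k * N in
  dt S = lap0 S - con v (fun p => D p S) + 2 * inner X X
    + 2 * c * (mtr H - N) ^+ 2 + 2 * k * inner H H + 2 * k * c * N ^+ 2.
Proof.
move=> Dk dtk S; have dtd := ft_der F.
have Dkw a u : D a (k * u) = k * D a u by rewrite DM Dk mul0r add0r.
have hS : dt S = dt (mtr X) + (dt (mtr H) - dt N) - k * dt N.
  by rewrite /S !(derD dtd) !(derN dtd) (derM dtd) dtk mul0r add0r.
have hD p : D p S = D p (mtr X) + (D p (mtr H) - D p N) - k * D p N.
  by rewrite /S !DD !DN Dkw.
have hL : lap0 S = lap0 (mtr X) + (lap0 (mtr H) - lap0 N) - k * lap0 N.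
  rewrite /lap0 -mtrZ -!mtrN -!mtrD; apply: eq_mtr => p q.
  by rewrite hD !DD !DN Dkw.
rewrite hS hL (conC v) (eq_conl _ hD) !conDl !conNl conZl.
rewrite dt_bakry_trace dt_lap_flow dt_grad_norm_flow; ring.
Qed.
End Flow.
End Potential.
End Calculus.

(** * The frame bundle in coordinates *)

(** The bracket of two vector fields is again a vector field, because the
   second-order terms cancel. Hence brackets can be checked on the coordinate
   functions. *)
Lemma vf_bracket (B : comPzRingType) (S : finType) (d : S -> B -> B)
    (x y : S -> B) u :
  (forall s, derivation (d s)) ->
  (forall s r u, d s (d r u) = d r (d s u)) ->
  \sum_s x s * d s (\sum_r y r * d r u)
    - \sum_s y s * d s (\sum_r x r * d r u) =
  \sum_s (\sum_r x r * d r (y s) - \sum_r y r * d r (x s)) * d s u.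
Proof.
move=> hd hc.
have e (x' y' : S -> B) : \sum_s x' s * d s (\sum_r y' r * d r u) =
    \sum_s (\sum_r x' r * d r (y' s)) * d s u
    + \sum_s \sum_r x' s * y' r * d s (d r u).
  under eq_bigr => s _ do rewrite (der_sumM (hd s)) mulrDr.
  rewrite big_split /=; congr (_ + _).
    under eq_bigr => s _ do rewrite mulr_sumr.
    rewrite exchange_big; apply: eq_bigr => s _; rewrite mulr_suml.
    by apply: eq_bigr => r _; rewrite mulrA.
  apply: eq_bigr => s _; rewrite mulr_sumr.
  by apply: eq_bigr => r _; rewrite mulrA.
rewrite !e.
have -> : \sum_s \sum_r y s * x r * d s (d r u) =
    \sum_s \sum_r x s * y r * d s (d r u).
  rewrite exchange_big; apply: eq_bigr => s _; apply: eq_bigr => r _.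
  by rewrite hc (mulrC (x s)).
under [RHS]eq_bigr => s _ do rewrite mulrBl.
rewrite sumrB; ring.
Qed.

(** Functions on the frame bundle over a coordinate domain, in an arbitrary
   ring. [bt], [bx i] and [bv b k] are the partial derivatives in t, in x^i and
   in e_b^k; [bz i] is x^i, [bfr a i] is e_a^i and [bth] is the inverse of the
   matrix e, which is the dual coframe. *)
Record frame_bundle (B : comPzRingType) (n : nat) := FrameBundle {
  bt : B -> B;
  bx : 'I_n -> B -> B;
  bv : 'I_n -> 'I_n -> B -> B;
  bz : 'I_n -> B;
  bfr : 'I_n -> 'I_n -> B;
  bth : 'I_n -> 'I_n -> B;
  bg : 'I_n -> 'I_n -> B;
  bgi : 'I_n -> 'I_n -> B;
  bhalf : B;
  bt_der : derivation bt;
  bx_der : forall i, derivation (bx i);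
  bv_der : forall b k, derivation (bv b k);
  btx : forall i u, bt (bx i u) = bx i (bt u);
  btv : forall b k u, bt (bv b k u) = bv b k (bt u);
  bxx : forall i j u, bx i (bx j u) = bx j (bx i u);
  bxv : forall i b k u, bx i (bv b k u) = bv b k (bx i u);
  bvv : forall b k c l u, bv b k (bv c l u) = bv c l (bv b k u);
  bx_z : forall i j, bx i (bz j) = (j == i)%:R;
  bv_z : forall b k j, bv b k (bz j) = 0;
  bt_e : forall a i, bt (bfr a i) = 0;
  bx_e : forall j a i, bx j (bfr a i) = 0;
  bv_e : forall b k a i, bv b k (bfr a i) = (a == b)%:R * (i == k)%:R;
  frame_coframe : forall a b, \sum_i bfr a i * bth i b = (a == b)%:R;
  coframe_frame : forall i j, \sum_a bth i a * bfr a j = (i == j)%:R;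
  bgC : forall i j, bg i j = bg j i;
  bgiC : forall i j, bgi i j = bgi j i;
  bgK : forall i j, \sum_k bg i k * bgi k j = (i == j)%:R;
  bv_g : forall b k i j, bv b k (bg i j) = 0;
  bv_gi : forall b k i j, bv b k (bgi i j) = 0;
  bhalfE : bhalf * 2 = 1 }.

Section Bundle.
Variables (B : comPzRingType) (n : nat) (P : frame_bundle B n).

Local Notation I := 'I_n.
Local Notation S := ('I_n + 'I_n * 'I_n)%type.
Local Notation dt := (bt P).
Local Notation dx := (bx P).
Local Notation dv := (bv P).
Local Notation e := (bfr P).
Local Notation th := (bth P).
Local Notation g := (bg P).
Local Notation gi := (bgi P).
Local Notation half := (bhalf P).

Definition bpd (s : S) : B -> B :=
  match s with inl i => dx i | inr bk => dv bk.1 bk.2 end.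

Lemma bpd_der s : derivation (bpd s).
Proof. by case: s => [i|[b k]]; [exact: bx_der|exact: bv_der]. Qed.

Lemma bpdC s r u : bpd s (bpd r u) = bpd r (bpd s u).
Proof.
case: s => [i|[b k]]; case: r => [j|[c l]] /=.
- exact: bxx.
- exact: bxv.
- by rewrite bxv.
- exact: bvv.
Qed.

Definition vf (x : S -> B) (u : B) : B := \sum_s x s * bpd s u.

Lemma vf_der x : derivation (vf x).
Proof.
split=> u v; rewrite /vf.
  by rewrite -big_split; apply: eq_bigr => s _; rewrite (derD (bpd_der s)) mulrDr.
rewrite mulr_suml mulr_sumr -big_split; apply: eq_bigr => s _.
by rewrite (derM (bpd_der s)) /=; ring.
Qed.

Lemma vf_comm x y u :
  vf x (vf y u) - vf y (vf x u) = vf (fun s => vf x (y s) - vf y (x s)) u.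
Proof. exact: (vf_bracket _ _ _ bpd_der bpdC). Qed.

Lemma vfE x u : vf x u =
  \sum_i x (inl i) * dx i u + \sum_b \sum_k x (inr (b, k)) * dv b k u.
Proof. by rewrite /vf big_sumType /= pair_big; congr (_ + _); apply: eq_bigr => -[]. Qed.

Lemma eq_vf x y u : x =1 y -> vf x u = vf y u.
Proof. by move=> h; apply: eq_bigr => s _; rewrite h. Qed.

Definition chris k i j := half * \sum_l gi k l * (dx i (g j l) + dx j (g i l) - dx l (g i j)).

(** Functions that come from the base. *)
Definition basic u := forall b k, dv b k u = 0.

Lemma basic_dx i u : basic u -> basic (dx i u).
Proof. by move=> h b k; rewrite -bxv h (der0 (bx_der P i)). Qed.
Lemma basicD u v : basic u -> basic v -> basic (u + v).
Proof. by move=> h h' b k; rewrite (derD (bv_der P b k)) h h' addr0. Qed.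
Lemma basicN u : basic u -> basic (- u).
Proof. by move=> h b k; rewrite (derN (bv_der P b k)) h oppr0. Qed.
Lemma basicB u v : basic u -> basic v -> basic (u - v).
Proof. by move=> h h'; apply: basicD => //; apply: basicN. Qed.
Lemma basicM u v : basic u -> basic v -> basic (u * v).
Proof. by move=> h h' b k; rewrite (derM (bv_der P b k)) h h' mul0r mulr0 addr0. Qed.
Lemma basic_sum (T : finType) (X : T -> B) :
  (forall i, basic (X i)) -> basic (\sum_i X i).
Proof.
by move=> h b k; rewrite (der_sum (bv_der P b k)) big1 // => i _; rewrite h.
Qed.
Lemma der_half d : derivation d -> d half = 0.
Proof.
move=> hd; have h : d (half * 2) = 0 by rewrite bhalfE (der1 hd).
rewrite (derM hd) (der_nat hd) mulr0 addr0 in h.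
by rewrite -[LHS]mulr1 -(bhalfE P) mulrCA h mulr0.
Qed.
Lemma basic_half : basic half.
Proof. by move=> b k; rewrite der_half //; exact: bv_der. Qed.
Lemma basic_g i j : basic (g i j). Proof. by move=> b k; exact: bv_g. Qed.
Lemma basic_gi i j : basic (gi i j). Proof. by move=> b k; exact: bv_gi. Qed.

Lemma basic_chr k i j : basic (chris k i j).
Proof.
apply: basicM; first exact: basic_half.
apply: basic_sum => l; apply: basicM; first exact: basic_gi.
by apply: basicB; [apply: basicD|]; apply: basic_dx; exact: basic_g.
Qed.

Lemma chrC k i j : chris k i j = chris k j i.
Proof.
rewrite /chris; congr (half * _); apply: eq_bigr => l _.
by rewrite (bgC P i j); ring.
Qed.

Lemma g_chr i j q : \sum_k g q k * chris k i j =
  half * (dx i (g j q) + dx j (g i q) - dx q (g i j)).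
Proof.
rewrite /chris.
transitivity (half * \sum_k \sum_l g q k * gi k l *
    (dx i (g j l) + dx j (g i l) - dx l (g i j))).
  rewrite mulr_sumr; apply: eq_bigr => k _; rewrite mulrCA; congr (half * _).
  by rewrite mulr_sumr; apply: eq_bigr => l _; rewrite mulrA.
congr (_ * _); rewrite exchange_big /=.
under eq_bigr => l _ do rewrite -mulr_suml bgK.
by rewrite sum_delta.
Qed.

(** The Levi-Civita connection preserves the metric. *)
Lemma metric_compat l i j : dx l (g i j) =
  \sum_m chris m l i * g m j + \sum_m chris m l j * g i m.
Proof.
under eq_bigr => m _ do rewrite mulrC bgC.
under [X in _ + X]eq_bigr => m _ do rewrite mulrC.
rewrite !g_chr (bgC P j i) (bgC P l i).
rewrite -[LHS]mul1r -(bhalfE P); ring.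
Qed.

(** The frame component of a covector from its coordinate components; [lift2],
   [lift3] and [lift4] do the same for higher ranks. *)
Definition lift1 a (X : I -> B) := \sum_i e a i * X i.

Lemma eq_lift1 a X Y : X =1 Y -> lift1 a X = lift1 a Y.
Proof. by move=> h; apply: eq_bigr => i _; rewrite h. Qed.
Lemma lift1D a X Y : lift1 a (fun i => X i + Y i) = lift1 a X + lift1 a Y.
Proof. by rewrite -big_split; apply: eq_bigr => i _; rewrite mulrDr. Qed.
Lemma lift1N a X : lift1 a (fun i => - X i) = - lift1 a X.
Proof. by rewrite -sumrN; apply: eq_bigr => i _; rewrite mulrN. Qed.
Lemma lift1B a X Y : lift1 a (fun i => X i - Y i) = lift1 a X - lift1 a Y.
Proof. by rewrite lift1D lift1N. Qed.
Lemma lift1Z a k X : lift1 a (fun i => k * X i) = k * lift1 a X.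
Proof. by rewrite mulr_sumr; apply: eq_bigr => i _; rewrite mulrCA. Qed.
Lemma lift1_exch a b X : lift1 a (fun i => lift1 b (X i)) = lift1 b (fun j => lift1 a (X^~ j)).
Proof.
rewrite /lift1; under eq_bigr => i _ do rewrite mulr_sumr.
rewrite exchange_big; apply: eq_bigr => j _; rewrite mulr_sumr.
by apply: eq_bigr => i _; rewrite mulrCA.
Qed.
Lemma lift1_sum a (T : finType) (X : T -> I -> B) :
  \sum_t lift1 a (X t) = lift1 a (fun i => \sum_t X t i).
Proof.
by rewrite exchange_big; apply: eq_bigr => i _; rewrite mulr_sumr.
Qed.
Lemma frame_inj (w : I -> B) : (forall i, \sum_a w a * e a i = 0) -> forall a, w a = 0.
Proof.
move=> h b; rewrite -(sum_delta b w).
transitivity (\sum_i (\sum_a w a * e a i) * th i b); last first.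
  by rewrite big1 // => i _; rewrite h mul0r.
under [RHS]eq_bigr => i _ do rewrite mulr_suml.
rewrite exchange_big; apply: eq_bigr => a _.
rewrite eq_sym -(frame_coframe P) mulrC mulr_sumr; apply: eq_bigr => i _; ring.
Qed.

(** Minus the speed of e_b^k along the horizontal field D_a, as dictated by
   parallel transport. *)
Definition conn a b k := lift1 a (fun i => lift1 b (fun j => chris k i j)).

Lemma connC a b k : conn a b k = conn b a k.
Proof.
by rewrite /conn lift1_exch; apply: eq_lift1 => i; apply: eq_lift1 => j; rewrite chrC.
Qed.

Definition hor a (s : S) : B :=
  match s with inl i => e a i | inr bk => - conn a bk.1 bk.2 end.
Definition ver c d (s : S) : B :=
  match s with inl i => 0 | inr bk => (bk.1 == c)%:R * e d bk.2 end.
Definition hder a := vf (hor a).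
Definition vder c d := vf (ver c d).
Local Notation D := hder.
Local Notation E := vder.

Let D_der a : derivation (D a) := vf_der _.
Let E_der c d : derivation (E c d) := vf_der _.

Lemma D_basic a u : basic u -> D a u = lift1 a (fun i => dx i u).
Proof.
move=> h; rewrite /D vfE /= [X in _ + X]big1 ?addr0 // => b _.
by rewrite big1 // => k _; rewrite h mulr0.
Qed.

Lemma EE c d u : E c d u = \sum_k e d k * dv c k u.
Proof.
rewrite /E vfE /= big1 ?add0r => [|i _]; last by rewrite mul0r.
rewrite -(sum_delta c (fun b => \sum_k e d k * dv b k u)).
apply: eq_bigr => b _; rewrite mulr_sumr; apply: eq_bigr => k _.
by rewrite eq_sym mulrA.
Qed.

Lemma E_basic c d u : basic u -> E c d u = 0.
Proof. by move=> h; rewrite EE big1 // => k _; rewrite h mulr0. Qed.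

Lemma E_e c d a i : E c d (e a i) = (a == c)%:R * e d i.
Proof.
rewrite EE -[e d i](sum_delta i (fun k => e d k)) mulr_sumr.
by apply: eq_bigr => k _; rewrite bv_e; ring.
Qed.

Lemma D_e a b k : D a (e b k) = - conn a b k.
Proof.
rewrite /D vfE /= big1 ?add0r => [|i _]; last by rewrite bx_e mulr0.
rewrite -[RHS](sum_delta b (fun c => - conn a c k)).
apply: eq_bigr => c _; rewrite -(sum_delta k (fun l => - conn a c l)) mulr_sumr.
by apply: eq_bigr => l _; rewrite bv_e; ring.
Qed.

Lemma E_lift1 c d a X : E c d (lift1 a X) =
  (a == c)%:R * lift1 d X + lift1 a (fun i => E c d (X i)).
Proof.
rewrite (der_sumM (E_der c d)); congr (_ + _).
by rewrite mulr_sumr; apply: eq_bigr => i _; rewrite E_e mulrA.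
Qed.

(** Differentiating the frame in a frame component produces exactly the
   Christoffel term of a covariant derivative. Applied once for each index, it
   shows that [hder] is covariant differentiation. *)
Lemma D_lift1_gen c a X : D c (lift1 a X) = lift1 a (fun i =>
  D c (X i) - lift1 c (fun l => \sum_m chris m l i * X m)).
Proof.
rewrite (der_sumM (D_der c)) addrC lift1B; congr (_ + _).
transitivity (- \sum_m lift1 c (fun l => lift1 a (fun i => chris m l i * X m))).
  rewrite -sumrN; apply: eq_bigr => m _; rewrite D_e mulNr; congr (- _).
  rewrite mulrC -lift1Z; apply: eq_lift1 => l; rewrite -lift1Z.
  by apply: eq_lift1 => i; rewrite mulrC.
rewrite lift1_sum; congr (- _).
by rewrite [RHS]lift1_exch; under eq_lift1 => l do rewrite lift1_sum.
Qed.

Definition lift2 (T : I -> I -> B) a b := lift1 a (fun i => lift1 b (T i)).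
Definition lift3 (T : I -> I -> I -> B) a b c := lift1 a (fun i => lift2 (T i) b c).
Definition lift4 (T : I -> I -> I -> I -> B) a b c d :=
  lift1 a (fun i => lift3 (T i) b c d).

Lemma connE a b k : conn a b k = lift2 (chris k) a b. Proof. by []. Qed.

Lemma E_lift2 c d T a b : (forall i j, basic (T i j)) ->
  E c d (lift2 T a b) = (a == c)%:R * lift2 T d b + (b == c)%:R * lift2 T a d.
Proof.
move=> hT; rewrite /lift2 E_lift1; congr (_ + _); rewrite -lift1Z; apply: eq_lift1 => i.
rewrite E_lift1 -[RHS]addr0; congr (_ + _).
by rewrite /lift1 big1 // => j _; rewrite E_basic ?mulr0.
Qed.

Definition nab1 (w : I -> B) i j := dx i (w j) - \sum_m chris m i j * w m.
Definition nab2 (T : I -> I -> B) i j k :=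
  dx i (T j k) - \sum_m chris m i j * T m k - \sum_m chris m i k * T j m.
Definition nab3 (T : I -> I -> I -> B) i j k l :=
  dx i (T j k l) - \sum_m chris m i j * T m k l - \sum_m chris m i k * T j m l
  - \sum_m chris m i l * T j k m.

Lemma D_lift1_cov c a X (Y : I -> I -> B) : (forall i, D c (X i) = lift1 c (Y i)) ->
  D c (lift1 a X) = lift1 c (fun l => lift1 a (fun i => Y i l - \sum_m chris m l i * X m)).
Proof.
move=> h; rewrite D_lift1_gen [RHS]lift1_exch; apply: eq_lift1 => i.
by rewrite h lift1B.
Qed.

Lemma D_lift1 w c a : (forall j, basic (w j)) ->
  D c (lift1 a w) = lift2 (nab1 w) c a.
Proof.
move=> h.
exact: (@D_lift1_cov c a w (fun i l => dx l (w i)) (fun i => D_basic c (h i))).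
Qed.

Lemma D_lift2 T c a b : (forall i j, basic (T i j)) ->
  D c (lift2 T a b) = lift3 (nab2 T) c a b.
Proof.
move=> h; rewrite (@D_lift1_cov c a (fun i => lift1 b (T i))
  (fun i l => lift1 b (nab1 (T i) l))) => [|i].
  apply: eq_lift1 => l; apply: eq_lift1 => i; 
  under [X in _ - X]eq_bigr => m _ do rewrite -lift1Z.
  rewrite lift1_sum -lift1B; apply: eq_lift1 => j; rewrite /nab1 /nab2; ring.
exact: D_lift1.
Qed.

Lemma sum_lift2 (k : I -> B) (T : I -> I -> I -> B) a b :
  \sum_m k m * lift2 (T m) a b = lift2 (fun i j => \sum_m k m * T m i j) a b.
Proof.
under eq_bigr => m _ do rewrite -lift1Z.
rewrite lift1_sum; apply: eq_lift1 => i; under eq_bigr => m _ do rewrite -lift1Z.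
by rewrite lift1_sum.
Qed.

Lemma D_lift3 T c a b d : (forall i j k, basic (T i j k)) ->
  D c (lift3 T a b d) = lift4 (nab3 T) c a b d.
Proof.
move=> h; rewrite (@D_lift1_cov c a (fun i => lift2 (T i) b d)
  (fun i l => lift2 (nab2 (T i) l) b d)) => [|i].
  apply: eq_lift1 => l; apply: eq_lift1 => i.
  rewrite sum_lift2 /lift2 -lift1B; apply: eq_lift1 => j.
  rewrite -lift1B; apply: eq_lift1 => k; rewrite /nab2 /nab3; ring.
by apply: D_lift2.
Qed.

Lemma D_curv a b c k : D a (conn b c k) = lift3 (fun l j m => dx l (chris k j m)
    - \sum_r chris r l m * chris k j r
    - \sum_r chris r l j * chris k r m) a b c.
Proof.
rewrite -[conn b c k]/(lift2 (chris k) b c) D_lift2; last first.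
  by move=> i j; exact: basic_chr.
apply: eq_lift1 => l; apply: eq_lift1 => j; apply: eq_lift1 => m; rewrite /nab2; ring.
Qed.

Definition curv_coef i j m k := dx i (chris k j m) - dx j (chris k i m)
  + \sum_l (chris l j m * chris k i l - chris l i m * chris k j l).

(** The bracket of two horizontal fields is vertical, with the curvature as
   coefficient: the products of Christoffel symbols in [curv_coef] come from
   differentiating the frame in [conn]. *)
Lemma conn_curv a b c k : D a (conn b c k) - D b (conn a c k) =
  lift3 (fun i j m => curv_coef i j m k) a b c.
Proof.
rewrite !D_curv {2}/lift3 [X in _ - X]lift1_exch -lift1B; apply: eq_lift1 => i.
rewrite -lift1B; apply: eq_lift1 => j; rewrite -lift1B; apply: eq_lift1 => m.
rewrite /curv_coef sumrB.
under [\sum_r chris r j i * _]eq_bigr => r _ do rewrite chrC.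
ring.
Qed.

Definition Rup a b c d :=
  \sum_k lift3 (fun i j m => curv_coef i j m k) a b c * th k d.

Definition Cup a b c := \sum_k dt (conn a b k) * th k c.

Lemma sum_th (X : I -> B) k : \sum_d (\sum_l X l * th l d) * e d k = X k.
Proof.
rewrite -(sum_delta k X).
under eq_bigr => d _ do rewrite mulr_suml.
rewrite exchange_big; apply: eq_bigr => l _.
by rewrite eq_sym -(coframe_frame P) mulrC mulr_sumr; apply: eq_bigr => d _; rewrite mulrA.
Qed.

Lemma vf_ver (X : I -> I -> B) u :
  vf (fun s => match s with inl _ => 0 | inr bk => - X bk.1 bk.2 end) u =
  - \sum_c \sum_d (\sum_l X c l * th l d) * E c d u.
Proof.
rewrite vfE /= big1 ?add0r => [|i _]; last by rewrite mul0r.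
rewrite -sumrN; apply: eq_bigr => c _.
under [X in _ = - X]eq_bigr => d _ do rewrite EE mulr_sumr.
rewrite [X in _ = - X]exchange_big -sumrN; apply: eq_bigr => k _ /=.
rewrite mulNr -(sum_th (X c) k) mulr_suml; congr (- _).
by apply: eq_bigr => d _; rewrite mulrA.
Qed.

Lemma comm_hder_hder a b u : D a (D b u) - D b (D a u) =
  - \sum_c \sum_d Rup a b c d * E c d u.
Proof.
rewrite vf_comm -vf_ver; apply: eq_vf => -[i|[c k]] /=; rewrite -/(D a) -/(D b).
  by rewrite !D_e connC subrr.
by rewrite !(derN (D_der _)) -conn_curv opprB addrC opprK.
Qed.

Lemma comm_vder_hder c d a u :
  E c d (D a u) = D a (E c d u) + (a == c)%:R * D d u.
Proof.
have h : vf (fun s => (a == c)%:R * hor d s) u = (a == c)%:R * D d u.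
  by rewrite mulr_sumr; apply: eq_bigr => s _; rewrite mulrA.
rewrite -h addrC; apply/eqP; rewrite -subr_eq; apply/eqP.
rewrite vf_comm; apply: eq_vf => -[i|[b k]] /=; rewrite -/(D a) -/(E c d).
  by rewrite E_e (der0 (D_der a)) subr0.
rewrite (derN (E_der c d)) connE (E_lift2 c d a b (basic_chr k)) (derM (D_der a)).
rewrite (der_nat (D_der a)) D_e !connE; ring.
Qed.

Lemma comm_time_hder a u : dt (D a u) =
  D a (dt u) - \sum_b \sum_c Cup a b c * E b c u.
Proof.
rewrite -(vf_ver (fun b k => dt (conn a b k))).
rewrite (der_sumM (bt_der P)) addrC; congr (_ + _).
  by apply: eq_bigr => -[i|[b k]] _ /=; rewrite ?btx ?btv.
apply: eq_bigr => -[i|[b k]] _ /=; first by rewrite bt_e.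
by rewrite (derN (bt_der P)).
Qed.

Lemma comm_time_vder c d u : dt (E c d u) = E c d (dt u).
Proof.
rewrite !EE (der_sumM (bt_der P)) big1 ?add0r => [|k _]; last first.
  by rewrite bt_e mul0r.
by apply: eq_bigr => k _; rewrite btv.
Qed.

(** Apply the relation to x^i, which only the horizontal fields move, and then
   to e_c^k; the matrix e is invertible. *)
Lemma hder_vder_free w v :
  (forall u, \sum_c \sum_d w c d * E c d u + \sum_a v a * D a u = 0) ->
  (forall c d, w c d = 0) /\ (forall a, v a = 0).
Proof.
move=> h.
have hv : forall a, v a = 0.
  apply: frame_inj => i; have := h (bz P i).
  rewrite [X in X + _]big1 ?add0r => [|c _]; last first.
    by rewrite big1 // => d _; rewrite E_basic ?mulr0 // => b k; exact: bv_z.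
  move=> hz; rewrite -[RHS]hz; apply: eq_bigr => a _; rewrite D_basic;
    last by move=> b k; exact: bv_z.
  congr (_ * _); rewrite -(sum_delta i (e a)); apply: eq_bigr => j _.
  by rewrite bx_z mulrC.
split=> // c; apply: frame_inj => k; have := h (e c k).
rewrite [X in _ + X]big1 ?addr0 => [hz|a _]; last by rewrite hv mul0r.
rewrite -[RHS]hz.
rewrite -(sum_delta c (fun b => \sum_d w b d * e d k)); apply: eq_bigr => b _.
rewrite mulr_sumr; apply: eq_bigr => d _; rewrite E_e; ring.
Qed.

Definition frame_g := lift2 g.
Definition frame_gi a b := \sum_i \sum_j th i a * th j b * gi i j.

Lemma frame_gC a b : frame_g a b = frame_g b a.
Proof.
by rewrite /frame_g /lift2 lift1_exch; apply: eq_lift1 => i; apply: eq_lift1 => j; rewrite bgC.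
Qed.
Lemma frame_giC a b : frame_gi a b = frame_gi b a.
Proof.
rewrite /frame_gi exchange_big; apply: eq_bigr => i _; apply: eq_bigr => j _.
by rewrite bgiC; ring.
Qed.
Lemma frame_gK a b : \sum_c frame_g a c * frame_gi c b = (a == b)%:R.
Proof.
have sth i j : \sum_c e c i * th j c = (i == j)%:R.
  by rewrite eq_sym -(coframe_frame P); apply: eq_bigr => c _; rewrite mulrC.
transitivity (\sum_c lift1 a (fun i => \sum_j e c j * (\sum_l \sum_m
    th l c * th m b * (g i j * gi l m)))).
  apply: eq_bigr => c _; rewrite /frame_g /lift2 mulr_suml; apply: eq_bigr => i _.
  rewrite -mulrA; congr (_ * _); rewrite mulr_suml; apply: eq_bigr => j _.
  rewrite -mulrA; congr (_ * _); rewrite /frame_gi mulr_sumr; apply: eq_bigr => l _.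
  by rewrite mulr_sumr; apply: eq_bigr => m _; ring.
rewrite lift1_sum -(frame_coframe P); apply: eq_bigr => i _; congr (_ * _).
rewrite exchange_big /=.
transitivity (\sum_j \sum_l (j == l)%:R * \sum_m th m b * (g i j * gi l m)).
  apply: eq_bigr => j _; under eq_bigr => c _ do rewrite mulr_sumr.
  rewrite exchange_big; apply: eq_bigr => l _; rewrite -sth mulr_suml.
  apply: eq_bigr => c _ /=; rewrite !mulr_sumr; apply: eq_bigr => m _; ring.
under eq_bigr => j _ do rewrite sum_delta.
rewrite exchange_big /= -(sum_delta i (th^~ b)); apply: eq_bigr => m _.
rewrite -(bgK P) mulr_suml; apply: eq_bigr => j _; ring.
Qed.

Lemma hder_frame_g c a b : D c (frame_g a b) = 0.
Proof.
rewrite D_lift2; last exact: basic_g.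
rewrite /lift3 /lift1 big1 // => l _; rewrite /lift2 /lift1 big1 ?mulr0 // => i _.
rewrite big1 ?mulr0 // => j _; rewrite /nab2 metric_compat.
by ring.
Qed.

Definition ric_coef j m := \sum_k curv_coef k j m k.

Lemma basic_curv_coef i j m k : basic (curv_coef i j m k).
Proof.
have hc := basic_chr.
apply: basicD; first by apply: basicB; exact: basic_dx.
by apply: basic_sum => l; apply: basicB; exact: basicM.
Qed.

Lemma ric_Rup a b : \sum_p Rup p a b p = lift2 ric_coef a b.
Proof.
transitivity (\sum_k lift2 (fun j m => curv_coef k j m k) a b).
  rewrite exchange_big; apply: eq_bigr => k _.
  rewrite -(sum_delta k (fun i => lift2 (fun j m => curv_coef i j m k) a b)).
  transitivity (\sum_p \sum_i e p i * th k p
      * lift2 (fun j m => curv_coef i j m k) a b).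
    apply: eq_bigr => p _; rewrite mulr_suml; apply: eq_bigr => i _; ring.
  rewrite exchange_big; apply: eq_bigr => i _.
  rewrite -(coframe_frame P) mulr_suml; apply: eq_bigr => p _; ring.
rewrite lift1_sum; apply: eq_lift1 => j.
by rewrite lift1_sum; apply: eq_lift1 => m.
Qed.

Lemma vder_ric c d a b : E c d (\sum_p Rup p a b p) =
  (a == c)%:R * (\sum_p Rup p d b p) + (b == c)%:R * (\sum_p Rup p a d p).
Proof.
rewrite !ric_Rup; apply: E_lift2 => i j.
by apply: basic_sum => k; exact: basic_curv_coef.
Qed.

Lemma vder_frame_g c d a b : E c d (frame_g a b) =
  (a == c)%:R * frame_g d b + (b == c)%:R * frame_g a d.
Proof. by apply: E_lift2; exact: basic_g. Qed.

Definition calculus : frame_calculus B n :=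
  FrameCalculus D_der E_der (bt_der P) comm_vder_hder comm_hder_hder comm_time_vder comm_time_hder
    hder_vder_free frame_gC frame_giC frame_gK hder_frame_g vder_frame_g vder_ric (bhalfE P).

Lemma riem_lift4 a b c d : riem calculus a b c d =
  lift4 (fun i j m q => \sum_k g q k * curv_coef i j m k) a b c d.
Proof.
rewrite /riem /=.
transitivity (\sum_k lift1 d (fun q => g q k)
    * lift3 (fun i j m => curv_coef i j m k) a b c).
  transitivity (\sum_f \sum_k lift1 d (fun q => \sum_l e f l * g q l)
     * (lift3 (fun i j m => curv_coef i j m k) a b c * th k f)).
    by apply: eq_bigr => f _; rewrite mulr_sumr.
  rewrite exchange_big; apply: eq_bigr => k _ /=.
  rewrite -(sum_delta k (fun l => lift1 d (g^~ l))) mulr_suml.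
  transitivity (\sum_f \sum_l th k f * e f l * lift1 d (g^~ l)
     * lift3 (fun i j m => curv_coef i j m k) a b c).
    apply: eq_bigr => f _; rewrite -lift1_sum mulr_suml; apply: eq_bigr => l _.
    rewrite (lift1Z d (e f l) (g^~ l)); ring.
  rewrite exchange_big; apply: eq_bigr => l _.
  by rewrite -(coframe_frame P) !mulr_suml.
rewrite /lift4 /lift3 /lift2.
under eq_bigr => k _ do rewrite -lift1Z.
rewrite lift1_sum; apply: eq_lift1 => i; under eq_bigr => k _ do rewrite -lift1Z.
rewrite lift1_sum; apply: eq_lift1 => j; under eq_bigr => k _ do rewrite -lift1Z.
rewrite lift1_sum; apply: eq_lift1 => m.
under eq_bigr => k _ do rewrite mulrC -lift1Z.
rewrite lift1_sum; apply: eq_lift1 => q; apply: eq_bigr => k _; ring.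
Qed.

Lemma bt_lift1 a X : dt (lift1 a X) = lift1 a (fun i => dt (X i)).
Proof.
rewrite (der_sumM (bt_der P)) big1 ?add0r // => i _.
by rewrite bt_e mul0r.
Qed.

Lemma th_lift1 k X : \sum_p th k p * lift1 p X = X k.
Proof.
rewrite -[RHS](sum_delta k X).
under eq_bigr => p _ do rewrite mulr_sumr.
rewrite exchange_big; apply: eq_bigr => i _; rewrite -(coframe_frame P) mulr_suml.
by apply: eq_bigr => p _; rewrite mulrA.
Qed.

Lemma mtr_lift2 T : mtr calculus (lift2 T) = \sum_i \sum_j gi i j * T i j.
Proof.
transitivity (\sum_p \sum_k th k p * \sum_l gi k l *
    lift1 p (fun i => \sum_q th l q * lift1 q (T i))).
  apply: eq_bigr => p _.
  transitivity (\sum_q \sum_k \sum_l th k p * (gi k l *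
      (th l q * lift2 T p q))).
    apply: eq_bigr => q _; rewrite mulr_suml; apply: eq_bigr => k _.
    rewrite mulr_suml; apply: eq_bigr => l _; ring.
  rewrite exchange_big; apply: eq_bigr => k _; rewrite exchange_big mulr_sumr.
  apply: eq_bigr => l _ /=; rewrite -!mulr_sumr; congr (_ * (_ * _)).
  rewrite -lift1_sum; apply: eq_bigr => q _; rewrite -lift1Z.
  by [].
rewrite exchange_big; apply: eq_bigr => k _ /=.
under eq_bigr => p _ do under eq_bigr => l _ do rewrite -lift1Z.
under eq_bigr => p _ do rewrite lift1_sum.
rewrite th_lift1; apply: eq_bigr => l _; by rewrite th_lift1.
Qed.
End Bundle.

(** * Functions of class C^m and the theorem of Schwarz *)
Lemma cancel_eq (R : fieldType) (k X Y a b : R) : k != 0 ->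
  X = k * a -> Y = k * b -> X = Y -> a = b.
Proof. by move=> k0 -> -> /(mulfI k0). Qed.

Lemma dist_le_half2 (R : realFieldType) (a b c e : R) :
  `|a - c| < e / 2 -> `|b - c| < e / 2 -> `|a - b| <= e.
Proof.
move=> ac bc; rewrite -(subrKA c) (splitr e).
by apply: le_trans (ler_normD _ _) _; rewrite lerD ?ltW // distrC.
Qed.

Section CkTheory.
Variables (R : realType) (E : normedModType R) (O : set E).
Hypothesis Oo : open O.
Implicit Types F G : E -> R.

Lemma near_open x : O x -> \forall y \near x, O y.
Proof. by move=> Ox; apply: open_nbhs_nbhs; split. Qed.

Lemma near_eq_on F G x : (forall y, O y -> F y = G y) -> O x ->
  \near x, F x = G x.
Proof. by move=> FG Ox; near=> y; apply: FG; near: y; exact: near_open.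
Unshelve. all: by end_near. Qed.

Lemma continuous_on_ext F G x : (forall y, O y -> F y = G y) -> O x ->
  {for x, continuous F} -> {for x, continuous G}.
Proof.
move=> FG Ox cF; change (G @ x --> G x); rewrite -(FG x Ox).
apply: cvg_trans cF; apply: near_eq_cvg; near=> y; apply: FG; near: y.
exact: near_open.
Unshelve. all: by end_near. Qed.

Lemma Ck_ext m F G : (forall x, O x -> F x = G x) -> Ck m O F -> Ck m O G.
Proof.
elim: m F G => [|m IH] F G FG /= [cF dF]; split=> //.
- by move=> x Ox; apply: continuous_on_ext FG Ox (cF x Ox).
- by move=> x Ox; apply: continuous_on_ext FG Ox (cF x Ox).
- move=> v; have [d1 d2] := dF v; split.
    move=> x Ox; apply: near_eq_derivable (d1 x Ox).
    exact: near_eq_on.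
  apply: IH d2 => x Ox; apply: near_eq_derive.
  exact: near_eq_on.
Qed.

Lemma CkW m F : Ck m.+1 O F -> Ck m O F.
Proof.
elim: m F => [|m IH] F; first by case=> ? _; split.
move=> [cF dF]; split=> // v; have [d1 d2] := dF v; split=> //.
exact: IH.
Qed.

Lemma Ck_cst m (a : R) : Ck m O (cst a).
Proof.
elim: m a => [|m IH] a /=; split=> //.
- by move=> x _; exact: cst_continuous.
- by move=> x _; exact: cst_continuous.
- move=> v; split; first by move=> x _; exact: derivable_cst.
  by apply: Ck_ext (IH 0) => x _; rewrite derive_cst.
Qed.

Lemma Ck_D m F G : Ck m O F -> Ck m O G -> Ck m O (fun x => F x + G x).
Proof.
elim: m F G => [|m IH] F G [cF dF] [cG dG]; split=> //.
- by move=> x Ox; apply: continuousD; [exact: cF|exact: cG].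
- by move=> x Ox; apply: continuousD; [exact: cF|exact: cG].
- move=> v; have [d1 d2] := dF v; have [e1 e2] := dG v; split.
    by move=> x Ox; apply: derivableD; [exact: d1|exact: e1].
  apply: Ck_ext (IH _ _ d2 e2) => x Ox.
  by rewrite (deriveD (d1 x Ox) (e1 x Ox)).
Qed.

Lemma Ck_M m F G : Ck m O F -> Ck m O G -> Ck m O (fun x => F x * G x).
Proof.
elim: m F G => [|m IH] F G hF hG; have [cF dF] := hF; have [cG dG] := hG;
  split=> //.
- by move=> x Ox; apply: continuousM; [exact: cF|exact: cG].
- by move=> x Ox; apply: continuousM; [exact: cF|exact: cG].
- move=> v; have [d1 d2] := dF v; have [e1 e2] := dG v; split.
    by move=> x Ox; apply: derivableM; [exact: d1|exact: e1].
  have := Ck_D (IH _ _ (CkW hF) e2) (IH _ _ (CkW hG) d2).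
  apply: Ck_ext => x Ox.
  by rewrite (deriveM (d1 x Ox) (e1 x Ox)).
Qed.

Lemma Ck_V m F : (forall x, O x -> F x != 0) -> Ck m O F ->
  Ck m O (fun x => (F x)^-1).
Proof.
move=> F0; elim: m => [|m IH] hF; have [cF dF] := hF; split=> //.
- by move=> x Ox; apply: continuousV; [exact: F0|exact: cF].
- by move=> x Ox; apply: continuousV; [exact: F0|exact: cF].
- move=> v; have [d1 d2] := dF v; split.
    by move=> x Ox; apply: derivableV; [exact: F0|exact: d1].
  have hi := IH (CkW hF).
  have := Ck_M (Ck_M (Ck_cst m (-1)) (Ck_M hi hi)) d2.
  apply: Ck_ext => x Ox.
  rewrite (deriveV (F0 x Ox) (d1 x Ox)) /= mulN1r -invfM -expr2.
  by [].
Qed.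

Lemma is_derive_lin (F : E -> R) x v :
  (forall a x y, F (a *: x + y) = a * F x + F y) -> is_derive x v F (F v).
Proof.
move=> lF.
have e : (fun h : R => h^-1 *: ((F \o shift x) (h *: v) - F x)) @ 0^' --> F v.
  apply: cvg_trans (@cvg_cst _ (F v) _ 0^' _); apply: near_eq_cvg.
  near=> h; rewrite /= lF addrK.
  have h0 : h != 0 by near: h; exact: nbhs_dnbhs_neq.
  by rewrite /GRing.scale /= mulrA mulVf // mul1r.
split; first by apply/cvg_ex; exists (F v).
exact: cvg_lim e.
Unshelve. all: by end_near. Qed.

Lemma Ck_linear m (F : E -> R) :
  (forall x, continuous_at x F) ->
  (forall a x y, F (a *: x + y) = a * F x + F y) -> Ck m O F.
Proof.
move=> cF lF.
have dF v x : is_derive x v F (F v) by exact: is_derive_lin.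
case: m => [|m]; split=> //; try by move=> x _; exact: cF.
move=> v; split; first by move=> x _; have [] := dF v x.
by apply: Ck_ext (Ck_cst m (F v)) => x _; have [_ ->] := dF v x.
Qed.

Lemma is_derive_line F (q v : E) (s : R) : derivable F (s *: v + q) v ->
  is_derive s (1 : R) (fun r => F (r *: v + q)) ('D_v F (s *: v + q)).
Proof.
have e : (fun h : R => h^-1 *: (((fun r => F (r *: v + q)) \o shift s) (h *: (1 : R))
     - F (s *: v + q))) =
   (fun h : R => h^-1 *: ((F \o shift (s *: v + q)) (h *: v) - F (s *: v + q))).
  apply/funext => h /=; congr (_ *: (F _ - _)).
  by rewrite scalerDl -addrA /GRing.scale /= mulr1.
move=> dF; split; first by rewrite /derivable e.
by rewrite /derive e.
Qed.

Lemma mvt_line F (q v : E) (h : R) : 0 < h ->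
  (forall s, 0 <= s <= h -> derivable F (s *: v + q) v) ->
  exists2 s, 0 <= s <= h & F (h *: v + q) - F q = h * 'D_v F (s *: v + q).
Proof.
move=> h0 dF.
have [||s] := @MVT R (fun r => F (r *: v + q))
    (fun s => 'D_v F (s *: v + q)) 0 h h0.
- move=> s; rewrite in_itv /= => /andP[s0 sh]; apply: is_derive_line; apply: dF.
  by rewrite !ltW.
- apply: derivable_within_continuous => s; rewrite in_itv /= => sh.
  by have [] := is_derive_line (dF s sh).
- rewrite in_itv /= => /andP[s0 sh] e; exists s; first by rewrite !ltW.
  by move: e; rewrite scale0r add0r subr0 mulrC.
Qed.

(** A second difference of F over a parallelogram with sides h v and h w is a
   mixed derivative at an interior point: apply the mean value theorem in the
   direction v to the difference of two translates of F, then in the direction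
   w. *)
Lemma mixed_difference F (p v w : E) (h : R) : 0 < h ->
  (forall s r, 0 <= s <= h -> 0 <= r <= h ->
    derivable F (s *: v + (r *: w + p)) v) ->
  (forall s r, 0 <= s <= h -> 0 <= r <= h ->
    derivable ('D_v F) (s *: v + (r *: w + p)) w) ->
  exists s r, [/\ 0 <= s <= h, 0 <= r <= h &
    F (h *: v + (h *: w + p)) - F (h *: w + p) - F (h *: v + p) + F p =
    h * h * 'D_w ('D_v F) (s *: v + (r *: w + p))].
Proof.
move=> h0 dF ddF.
have h1 : 0 <= h <= h by rewrite lexx ltW.
have h2 : 0 <= (0 : R) <= h by rewrite lexx ltW.
pose G x := F (x + h *: w) - F x.
have sh x : (fun y => F (y + h *: w)) = F \o shift (h *: w) by [].
have dsh x : derivable F (x + h *: w) v ->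
    is_derive x v (fun y => F (y + h *: w)) ('D_v F (x + h *: w)).
  have e : (fun t : R => t^-1 *: (((fun y => F (y + h *: w)) \o shift x) (t *: v)
     - F (x + h *: w))) =
     (fun t : R => t^-1 *: ((F \o shift (x + h *: w)) (t *: v) - F (x + h *: w))).
    by apply/funext => t /=; rewrite -addrA.
  move=> d; split; first by rewrite /derivable e.
  by rewrite /derive e.
have ac s r : s *: v + (r *: w + p) = r *: w + (s *: v + p).
  by rewrite addrCA.
have dG s : 0 <= s <= h -> is_derive (s *: v + p) v G
    ('D_v F (s *: v + p + h *: w) - 'D_v F (s *: v + p)).
  move=> hs; apply: is_deriveB.
    by apply: dsh; rewrite addrC -ac; exact: dF.
  by apply: derivableP; have := dF s 0 hs h2; rewrite scale0r add0r.
have [|s hs es] := @mvt_line G p v h h0.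
  by move=> s hs; have [] := dG s hs.
have [|r hr er] := @mvt_line ('D_v F) (s *: v + p) w h h0.
  by move=> r hr; rewrite -ac; exact: ddF.
exists s, r; split; [exact: hs|exact: hr|].
rewrite (ac s r) -mulrA -er (addrC (h *: w) (s *: v + p)).
have [_ <-] := dG s hs; rewrite -es /G.
rewrite (addrC p) -[h *: v + p + _]addrA [p + _]addrC; ring.
Qed.

(** The second difference is symmetric in v and w, so [mixed_difference]
   provides points arbitrarily near p where the two mixed derivatives agree. *)
Lemma schwarz F (v w p : E) : O p ->
  (forall x, O x -> derivable F x v) -> (forall x, O x -> derivable F x w) ->
  (forall x, O x -> derivable ('D_v F) x w) ->
  (forall x, O x -> derivable ('D_w F) x v) ->
  {for p, continuous ('D_w ('D_v F))} -> {for p, continuous ('D_v ('D_w F))} ->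
  'D_w ('D_v F) p = 'D_v ('D_w F) p.
Proof.
move=> Op dv dw dvw dwv cvw cwv.
apply/eqP; rewrite -subr_eq0 -normr_le0; apply/ler_addgt0Pl => e e0.
rewrite addr0.
have e2 : 0 < e / 2 by rewrite divr_gt0.
pose A := [set y | `|'D_w ('D_v F) p - 'D_w ('D_v F) y| < e / 2].
pose B := [set y | `|'D_v ('D_w F) p - 'D_v ('D_w F) y| < e / 2].
have nA : nbhs p A.
  have /cvgrPdist_lt/(_ _ e2) : 'D_w ('D_v F) @ p --> 'D_w ('D_v F) p := cvw.
  exact.
have nB : nbhs p B.
  have /cvgrPdist_lt/(_ _ e2) : 'D_v ('D_w F) @ p --> 'D_v ('D_w F) p := cwv.
  exact.
have /nbhs_ballP[d /= d0 hd] : nbhs p (O `&` (A `&` B)).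
  exact: filterI (near_open Op) (filterI nA nB).
pose K := `|v| + `|w| + 1.
have K0 : 0 < K by rewrite ltr_wpDl // addr_ge0.
(* h is small enough for the whole parallelogram to lie in the ball. *)
pose h := d / K.
have h0 : 0 < h by rewrite divr_gt0.
have inb s r : 0 <= s <= h -> 0 <= r <= h -> ball p d (s *: v + (r *: w + p)).
  move=> /andP[s0 sh] /andP[r0 rh]; rewrite -ball_normE /= distrC addrA addrK.
  apply: le_lt_trans (ler_normD _ _) _; rewrite !normrZ !ger0_norm //.
  have : s * `|v| + r * `|w| <= h * `|v| + h * `|w|.
    by rewrite lerD // ler_wpM2r.
  move/le_lt_trans; apply; rewrite -mulrDr /h mulrAC ltr_pdivrMr // ltr_pM2l //.
  by rewrite /K ltrDl.
have [s1 [r1 [hs1 hr1 E1]]] : exists s r, [/\ 0 <= s <= h, 0 <= r <= h &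
    F (h *: v + (h *: w + p)) - F (h *: w + p) - F (h *: v + p) + F p =
    h * h * 'D_w ('D_v F) (s *: v + (r *: w + p))].
  apply: (mixed_difference h0) => s r hs hr.
    by have [Oy _] := hd _ (inb s r hs hr); exact: dv.
  by have [Oy _] := hd _ (inb s r hs hr); exact: dvw.
have [r2 [s2 [hr2 hs2 E2]]] : exists s r, [/\ 0 <= s <= h, 0 <= r <= h &
    F (h *: w + (h *: v + p)) - F (h *: v + p) - F (h *: w + p) + F p =
    h * h * 'D_v ('D_w F) (s *: w + (r *: v + p))].
  apply: (mixed_difference h0) => s r hs hr; rewrite addrCA.
    by have [Oy _] := hd _ (inb r s hr hs); exact: dw.
  by have [Oy _] := hd _ (inb r s hr hs); exact: dwv.
have [_ [A1 _]] := hd _ (inb s1 r1 hs1 hr1).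
have [_ [_ B1]] := hd _ (inb s2 r2 hs2 hr2).
have AB : 'D_w ('D_v F) (s1 *: v + (r1 *: w + p)) =
    'D_v ('D_w F) (s2 *: v + (r2 *: w + p)).
  have hh : h * h != 0 by rewrite mulf_neq0 // gt_eqF.
  rewrite (addrCA (s2 *: v)); apply: (cancel_eq hh E1 E2).
  by rewrite (addrCA (h *: w)); ring.
rewrite /A /= AB in A1; rewrite /B /= in B1.
exact: (dist_le_half2 A1 B1).
Qed.
End CkTheory.

Lemma Ck_fst (R : realType) (E1 E2 : normedModType R) (O1 : set E1)
    (O : set (E1 * E2)%type) m (F : E1 -> R) : open O ->
  (forall z, O z -> O1 z.1) -> Ck m O1 F -> Ck m O (fun z => F z.1).
Proof.
move=> Oo sub; elim: m F => [|m IH] F [cF dF].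
  split=> // z Oz; apply: continuous_comp; last exact: cF (sub _ Oz).
  exact: cvg_fst.
split.
  move=> z Oz; apply: continuous_comp; last exact: cF (sub _ Oz).
  exact: cvg_fst.
move=> v; have [d1 d2] := dF v.1; split.
  by move=> z Oz; have := d1 _ (sub _ Oz).
exact: IH d2.
Qed.

(** * The ring of smooth functions on an open set *)

(** Functions are normalized to vanish outside the open set, so that equality of
   ring elements is equality on the open set. *)
Record sfun (R : realType) (E : normedModType R) (O : set E) (Oo : open O) := SFun {
  sfun_val :> E -> R;
  sfun_smooth : smooth_on O sfun_val;
  sfun_out : forall z, ~ O z -> sfun_val z = 0 }.

HB.instance Definition _ (R : realType) (E : normedModType R) (O : set E)
  (Oo : open O) := gen_eqMixin (sfun Oo).
HB.instance Definition _ (R : realType) (E : normedModType R) (O : set E)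
  (Oo : open O) := gen_choiceMixin (sfun Oo).

Section SmoothRing.
Variables (R : realType) (E : normedModType R) (O : set E) (Oo : open O).
Local Notation B := (sfun Oo).

Lemma sfunP (u v : B) : (forall z, O z -> u z = v z) -> u = v.
Proof.
case: u v => [u su u0] [v sv v0] /= uv.
have e : u = v.
  apply/funext => z; have [/uv //|nz] := pselect (O z).
  by rewrite u0 // v0.
by rewrite e in su u0 *; congr SFun; exact: Prop_irrelevance.
Qed.

Definition mask (F : E -> R) z := if `[< O z >] then F z else 0.

Lemma maskE F z : O z -> mask F z = F z.
Proof. by move=> Oz; rewrite /mask asboolT. Qed.

Lemma mask_out F z : ~ O z -> mask F z = 0.
Proof. by move=> Oz; rewrite /mask asboolF. Qed.

Lemma mask_smooth F : smooth_on O F -> smooth_on O (mask F).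
Proof. by move=> h m; apply: Ck_ext (h m) => // x Ox; rewrite maskE. Qed.

Definition mkS F (h : smooth_on O F) : B := SFun Oo (mask_smooth h) (@mask_out F).

Lemma mkSE F (h : smooth_on O F) z : O z -> mkS h z = F z.
Proof. exact: maskE. Qed.

Lemma smooth_cst a : smooth_on O (cst a). Proof. by move=> m; exact: Ck_cst. Qed.
Lemma smoothD F G : smooth_on O F -> smooth_on O G ->
  smooth_on O (fun x => F x + G x).
Proof. by move=> h k m; apply: Ck_D. Qed.
Lemma smoothM F G : smooth_on O F -> smooth_on O G ->
  smooth_on O (fun x => F x * G x).
Proof. by move=> h k m; apply: Ck_M. Qed.
Lemma smoothV F : (forall x, O x -> F x != 0) -> smooth_on O F ->
  smooth_on O (fun x => (F x)^-1).
Proof. by move=> h k m; apply: Ck_V. Qed.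
Lemma smooth_derive F v : smooth_on O F -> smooth_on O ('D_v F).
Proof. by move=> h m; have [_ /(_ v) []] := h m.+1. Qed.
Lemma smooth_derivable F v x : smooth_on O F -> O x -> derivable F x v.
Proof. by move=> h Ox; have [_ /(_ v) [d _]] := h 1%N; exact: d. Qed.
Lemma smooth_continuous F x : smooth_on O F -> O x -> {for x, continuous F}.
Proof. by move=> h Ox; have [c _] := h 0%N; exact: c. Qed.

Definition sconst a : B := mkS (smooth_cst a).
Definition sadd (u v : B) : B := mkS (smoothD (sfun_smooth u) (sfun_smooth v)).
Definition smul (u v : B) : B := mkS (smoothM (sfun_smooth u) (sfun_smooth v)).
Definition sopp (u : B) : B := smul (sconst (-1)) u.

Fact saddA : associative sadd.
Proof. by move=> u v w; apply: sfunP => z Oz; rewrite !mkSE // addrA. Qed.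
Fact saddC : commutative sadd.
Proof. by move=> u v; apply: sfunP => z Oz; rewrite !mkSE // addrC. Qed.
Fact sadd0 : left_id (sconst 0) sadd.
Proof. by move=> u; apply: sfunP => z Oz; rewrite !mkSE // add0r. Qed.
Fact saddN : left_inverse (sconst 0) sopp sadd.
Proof. by move=> u; apply: sfunP => z Oz; rewrite !mkSE //= mulN1r addNr. Qed.
Fact smulA : associative smul.
Proof. by move=> u v w; apply: sfunP => z Oz; rewrite !mkSE // mulrA. Qed.
Fact smulC : commutative smul.
Proof. by move=> u v; apply: sfunP => z Oz; rewrite !mkSE // mulrC. Qed.
Fact smul1 : left_id (sconst 1) smul.
Proof. by move=> u; apply: sfunP => z Oz; rewrite !mkSE // mul1r. Qed.
Fact smulDl : left_distributive smul sadd.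
Proof. by move=> u v w; apply: sfunP => z Oz; rewrite !mkSE // mulrDl. Qed.

HB.instance Definition _ := GRing.isZmodule.Build B saddA saddC sadd0 saddN.
HB.instance Definition _ :=
  GRing.Zmodule_isComPzRing.Build B smulA smulC smul1 smulDl.

Lemma sfunD (u v : B) z : O z -> (u + v : B) z = u z + v z.
Proof. exact: mkSE. Qed.
Lemma sfunM (u v : B) z : O z -> (u * v : B) z = u z * v z.
Proof. exact: mkSE. Qed.
Lemma sfunN (u : B) z : O z -> (- u : B) z = - u z.
Proof. by move=> Oz; rewrite [LHS]mkSE // mkSE // mulN1r. Qed.
Lemma sfun0 z : (0 : B) z = 0.
Proof. by have [Oz|Oz] := pselect (O z); [exact: mkSE|exact: sfun_out]. Qed.
Lemma sfun1 z : O z -> (1 : B) z = 1.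
Proof. exact: mkSE. Qed.
Lemma sfunB (u v : B) z : O z -> (u - v : B) z = u z - v z.
Proof. by move=> Oz; rewrite sfunD // sfunN. Qed.
Lemma sfun_sum (T : finType) (F : T -> B) z : O z ->
  (\sum_i F i : B) z = \sum_i F i z.
Proof.
move=> Oz; apply: (big_morph (fun u : B => u z)); last exact: sfun0.
by move=> u v; exact: sfunD.
Qed.
Lemma sconstE a z : O z -> sconst a z = a.
Proof. exact: mkSE. Qed.

Definition sder (v : E) (u : B) : B := mkS (smooth_derive v (sfun_smooth u)).

Lemma sderE v u z : O z -> sder v u z = 'D_v u z.
Proof. exact: mkSE. Qed.

Lemma sder_eq v (u : B) (F : E -> R) z : O z -> (forall y, O y -> u y = F y) ->
  sder v u z = 'D_v F z.
Proof.
move=> Oz uF; rewrite sderE //; apply: near_eq_derive.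
exact: (near_eq_on Oo).
Qed.

Lemma sder_der v : derivation (sder v).
Proof.
split=> u w; apply: sfunP => z Oz.
  rewrite sfunD // !sderE //.
  rewrite (@near_eq_derive _ _ _ _ (fun y => u y + w y)).
    by rewrite deriveD //; apply: smooth_derivable => //; exact: sfun_smooth.
  by apply: (near_eq_on Oo) => // y; exact: sfunD.
rewrite sfunD // !sfunM // !sderE //.
rewrite (@near_eq_derive _ _ _ _ (fun y => u y * w y)).
  rewrite deriveM; try by apply: smooth_derivable => //; exact: sfun_smooth.
  by rewrite /GRing.scale /= addrC; congr (_ + _); exact: mulrC.
by apply: (near_eq_on Oo) => // y; exact: sfunM.
Qed.

Lemma sderC v w u : sder v (sder w u) = sder w (sder v u).
Proof.
apply: sfunP => z Oz.
have su := sfun_smooth u; have du a := smooth_derive a su.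
have e a b := @sder_eq a (sder b u) ('D_b u) z Oz (fun y Oy => sderE b u Oy).
refine (etrans (e v w) (etrans _ (esym (e w v)))).
apply: (schwarz Oo Oz) => [x Ox|x Ox|x Ox|x Ox||].
- exact: smooth_derivable su Ox.
- exact: smooth_derivable su Ox.
- exact: smooth_derivable (du w) Ox.
- exact: smooth_derivable (du v) Ox.
- exact: smooth_continuous (smooth_derive v (du w)) Oz.
- exact: smooth_continuous (smooth_derive w (du v)) Oz.
Qed.

Lemma sder_const v a : sder v (sconst a) = 0.
Proof.
apply: sfunP => z Oz; rewrite sfun0 (@sder_eq v _ (cst a)) //.
  by rewrite derive_cst.
by move=> y; exact: sconstE.
Qed.

(** A function without zeros is invertible, and so is a matrix of functions that
   is invertible at every point: divide its adjugate by its determinant. *)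
Lemma sinv_ex (u : B) : (forall z, O z -> u z != 0) -> exists w, u * w = 1.
Proof.
move=> u0; exists (mkS (smoothV u0 (sfun_smooth u))).
by apply: sfunP => z Oz; rewrite sfunM // mkSE // sfun1 // mulfV ?u0.
Qed.

Lemma smx_inv_ex n (M : 'I_n -> 'I_n -> B) :
  (forall z, O z -> (\matrix_(i, j) M i j z) \in unitmx) ->
  exists M' : 'I_n -> 'I_n -> B,
    (forall i j, \sum_k M i k * M' k j = (i == j)%:R) /\
    (forall i j, \sum_k M' i k * M k j = (i == j)%:R).
Proof.
move=> hM; pose MM := \matrix_(i, j) M i j : 'M[B]_n.
have [w hw] : exists w, \det MM * w = 1.
  apply: sinv_ex => z Oz; have := hM z Oz; rewrite unitmxE unitfE.
  rewrite (_ : (\det MM : B) z = \det (\matrix_(i, j) M i j z)) //.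
  rewrite /determinant sfun_sum //; apply: eq_bigr => s _.
  rewrite sfunM //; congr (_ * _).
    by case: (perm.odd_perm s); rewrite ?expr1 ?expr0 ?sfunN ?sfun1.
  rewrite (big_morph (fun u : B => u z) (fun u v => sfunM u v Oz) (sfun1 Oz)).
  by apply: eq_bigr => i _; rewrite !mxE.
exists (fun i j => w * (\adj MM) i j); split=> i j.
  have := congr1 (fun A : 'M[B]_n => A i j) (mul_mx_adj MM).
  rewrite !mxE => h.
  transitivity (w * ((\det MM) *+ (i == j))).
    rewrite -h mulr_sumr; apply: eq_bigr => k _; rewrite !mxE; ring.
  by rewrite mulrnAr mulrC hw.
have := congr1 (fun A : 'M[B]_n => A i j) (mul_adj_mx MM).
rewrite !mxE => h.
transitivity (w * ((\det MM) *+ (i == j))).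
  rewrite -h mulr_sumr; apply: eq_bigr => k _; rewrite !mxE; ring.
by rewrite mulrnAr mulrC hw.
Qed.
End SmoothRing.

(** * The frame bundle over a chart *)
Lemma pos_def_unit (R : realFieldType) (n : nat) (A : 'M[R]_n) :
  (forall v : 'rV[R]_n, v != 0 ->
     0 < \sum_(i < n) \sum_(j < n) A i j * v 0 i * v 0 j) -> A \in unitmx.
Proof.
move=> pos; rewrite -row_free_unit -kermx_eq0.
apply/negP => /negP /rowV0Pn [v /sub_kermxP vA v0].
have := pos v v0.
rewrite exchange_big big1 ?ltxx // => j _.
have := congr1 (fun B : 'rV_n => B 0 j) vA.
rewrite !mxE => h; rewrite -mulr_suml.
rewrite (_ : \sum_i A i j * v 0 i = 0) ?mul0r //.
by rewrite -[RHS]h; apply: eq_bigr => i _; rewrite mulrC.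
Qed.

(** The next lemmas push a ring morphism through the right-hand sides. They are
   stated over abstract rings because matching in the ring of smooth functions
   would unfold its operations. *)
Section Evaluation.
Variables (B : comPzRingType) (R : comPzRingType) (ev : B -> R).
Hypothesis evD : forall u v, ev (u + v) = ev u + ev v.
Hypothesis evM : forall u v, ev (u * v) = ev u * ev v.
Hypothesis evN : forall u, ev (- u) = - ev u.
Hypothesis ev_n : forall k, ev k%:R = k%:R.

Let evE := (evD, evM, evN, ev_n).

Lemma eval_ric l q p d r1 r2 c L h hh w l' q' p' d' r1' r2' c' L' h' hh' w' :
  ev c = c' -> ev l = l' -> ev q = q' -> ev p = p' -> ev d = d' ->
  ev r1 = r1' -> ev r2 = r2' -> ev L = L' -> ev h = h' -> ev hh = hh' ->
  ev w = w' ->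
  ev (l + 2 * q - 2 * p - d - r1 - r2 + 2 * c * (L * h - hh - w)) =
  l' + 2 * q' - 2 * p' - d' - r1' - r2' + 2 * c' * (L' * h' - hh' - w').
Proof. by do 11!move=> <-; rewrite !evE. Qed.

Lemma eval_bakry l q p d c a1 v1 a2 v2 L N h l' q' p' d' c' a1' v1' a2' v2' L' N' h' :
  ev c = c' -> ev l = l' -> ev q = q' -> ev p = p' -> ev d = d' ->
  ev a1 = a1' -> ev v1 = v1' -> ev a2 = a2' -> ev v2 = v2' ->
  ev L = L' -> ev N = N' -> ev h = h' ->
  ev (l + 2 * q - 2 * p - d - c * (a1 * v1 + a2 * v2 - 2 * (L - N) * h)) =
  l' + 2 * q' - 2 * p' - d' - c' * (a1' * v1' + a2' * v2' - 2 * (L' - N') * h').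
Proof. by do 12!move=> <-; rewrite !evE. Qed.

Lemma eval_scal l i1 i2 d c L N l' i1' i2' d' c' L' N' :
  ev c = c' -> ev l = l' -> ev i1 = i1' -> ev i2 = i2' -> ev d = d' ->
  ev L = L' -> ev N = N' ->
  ev (l + 2 * i1 - 2 * i2 - d + 2 * c * L * (L - N)) =
  l' + 2 * i1' - 2 * i2' - d' + 2 * c' * L' * (L' - N').
Proof. by do 7!move=> <-; rewrite !evE. Qed.

Lemma eval_tilde l d i1 i2 c k L N l' d' i1' i2' c' k' L' N' :
  ev c = c' -> ev k = k' -> ev l = l' -> ev d = d' -> ev i1 = i1' ->
  ev i2 = i2' -> ev L = L' -> ev N = N' ->
  ev (l - d + 2 * i1 + 2 * c * (L - N) ^+ 2 + 2 * k * i2 + 2 * k * c * N ^+ 2) =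
  l' - d' + 2 * i1' + 2 * c' * (L' - N') ^+ 2 + 2 * k' * i2'
  + 2 * k' * c' * N' ^+ 2.
Proof. by do 8!move=> <-; rewrite !expr2 !evE. Qed.
End Evaluation.

Section LocalFlow.
Variables (R : realType) (n : nat).
Variables (I : set R) (U : set 'rV[R]_n) (Io : open I) (Uo : open U).
Variable g : R -> 'rV[R]_n -> 'I_n -> 'I_n -> R.
Variable f : R -> 'rV[R]_n -> R.
Hypothesis g_smooth : forall i j,
  smooth_on (I `*` U : set (R * 'rV[R]_n)%type) (fun tx => g tx.1 tx.2 i j).
Hypothesis g_sym : forall s y, I s -> U y -> forall i j, g s y i j = g s y j i.
Hypothesis g_unit : forall s y, I s -> U y ->
  (\matrix_(i, j) g s y i j) \in unitmx.
Hypothesis f_smooth :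
  smooth_on (I `*` U : set (R * 'rV[R]_n)%type) (fun tx => f tx.1 tx.2).

Local Notation E := ((R * 'rV[R]_n) * 'M[R]_n)%type.

Definition Odom : set E := [set z | [/\ I z.1.1, U z.1.2 & z.2 \in unitmx]].

Lemma cont_frame a i (z : E) : continuous_at z (fun z : E => z.2 a i).
Proof.
apply: (@continuous_comp _ _ _ (fun z : E => z.2) (fun M : 'M[R]_n => M a i)).
  exact: cvg_snd.
exact: coord_continuous.
Qed.

Lemma cont_coord i (z : E) : continuous_at z (fun z : E => z.1.2 0 i).
Proof.
apply: (@continuous_comp _ _ _ (fun z : E => z.1.2) (fun M : 'rV[R]_n => M 0 i)).
  apply: (@continuous_comp _ _ _ (fun z : E => z.1) (fun z => z.2)).
    exact: cvg_fst.
  exact: cvg_snd.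
exact: coord_continuous.
Qed.

Lemma Odom_open : open Odom.
Proof.
have e : Odom = ((fun z : E => z.1.1) @^-1` I `&` (fun z : E => z.1.2) @^-1` U)
    `&` (fun z : E => \det z.2) @^-1` [set x | x != 0].
  have u z : ((z.2 : 'M[R]_n) \in unitmx) = (\det (z : E).2 != 0).
    by rewrite unitmxE unitfE.
  apply/seteqP; split=> z /= [].
    by move=> a b c; split; [split|rewrite -u].
  by move=> [a b] c; split; rewrite ?u.
rewrite e; apply: openI; first apply: openI.
- apply: open_comp => // z _.
  apply: (@continuous_comp _ _ _ (fun z : E => z.1) (fun z => z.1)).
    exact: cvg_fst.
  exact: cvg_fst.
- apply: open_comp => // z _.
  apply: (@continuous_comp _ _ _ (fun z : E => z.1) (fun z => z.2)).
    exact: cvg_fst.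
  exact: cvg_snd.
- apply: open_comp; last exact: open_neq.
  move=> z _.
  rewrite (_ : (fun z : E => \det z.2) = fun z : E => \sum_(s : 'S_n)
     (-1) ^+ s * \prod_i z.2 i (s i)) //.
  apply: cvg_big => [|s _]; first exact: add_continuous.
  apply: cvgM; first exact: cvg_cst.
  apply: cvg_big => [|i _]; first exact: mul_continuous.
  exact: cont_frame.
Qed.

Notation B := (sfun Odom_open).

Definition dirt : E := ((1, 0), 0).
Definition dirx (i : 'I_n) : E := ((0, delta_mx 0 i), 0).
Definition dirv (b k : 'I_n) : E := ((0, 0), delta_mx b k).

Lemma frame_lin a i (k : R) (x y : E) :
  (k *: x + y).2 a i = k * x.2 a i + y.2 a i.
Proof. by rewrite /= !mxE. Qed.

Lemma coord_lin i (k : R) (x y : E) :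
  (k *: x + y).1.2 0 i = k * x.1.2 0 i + y.1.2 0 i.
Proof. by rewrite /= !mxE. Qed.

Definition eS a i : B := mkS Odom_open
  (fun m => Ck_linear Odom_open m (@cont_frame a i) (frame_lin a i)).
Definition zS i : B := mkS Odom_open
  (fun m => Ck_linear Odom_open m (@cont_coord i) (coord_lin i)).

Lemma Odom_fst z : Odom z -> (I `*` U) z.1.
Proof. by case. Qed.

Definition liftS (F : R * 'rV[R]_n -> R) (hF : smooth_on (I `*` U) F) : B :=
  mkS Odom_open (fun m => Ck_fst Odom_open Odom_fst (hF m)).

Definition gS i j : B := liftS (g_smooth i j).
Definition fS : B := liftS f_smooth.

Lemma eSE a i z : Odom z -> eS a i z = z.2 a i.
Proof. exact: mkSE. Qed.
Lemma gSE i j z : Odom z -> gS i j z = g z.1.1 z.1.2 i j.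
Proof. exact: mkSE. Qed.
Lemma fSE z : Odom z -> fS z = f z.1.1 z.1.2.
Proof. exact: mkSE. Qed.

Lemma thS_ex : exists th : 'I_n -> 'I_n -> B,
  (forall i j, \sum_k eS i k * th k j = (i == j)%:R) /\
  (forall i j, \sum_k th i k * eS k j = (i == j)%:R).
Proof.
apply: smx_inv_ex => z Oz.
rewrite (_ : \matrix_(i, j) _ = z.2); first by case: Oz.
by apply/matrixP => i j; rewrite mxE eSE.
Qed.

Lemma giS_ex : exists gi : 'I_n -> 'I_n -> B,
  (forall i j, \sum_k gS i k * gi k j = (i == j)%:R) /\
  (forall i j, \sum_k gi i k * gS k j = (i == j)%:R).
Proof.
apply: smx_inv_ex => z Oz; have [Iz Uz _] := Oz.
have := g_unit Iz Uz; congr (_ \in unitmx).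
by apply/matrixP => i j; rewrite !mxE gSE.
Qed.

Definition thS := projT1 (cid thS_ex).
Definition giS := projT1 (cid giS_ex).
Lemma eS_th i j : \sum_k eS i k * thS k j = (i == j)%:R.
Proof. exact: (projT2 (cid thS_ex)).1. Qed.
Lemma thS_e i j : \sum_k thS i k * eS k j = (i == j)%:R.
Proof. exact: (projT2 (cid thS_ex)).2. Qed.
Lemma gSK i j : \sum_k gS i k * giS k j = (i == j)%:R.
Proof. exact: (projT2 (cid giS_ex)).1. Qed.
Lemma giSK i j : \sum_k giS i k * gS k j = (i == j)%:R.
Proof. exact: (projT2 (cid giS_ex)).2. Qed.

Lemma gSC i j : gS i j = gS j i.
Proof.
by apply: sfunP => z Oz; rewrite !gSE //; case: Oz => Iz Uz _; exact: g_sym.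
Qed.

Lemma giSC i j : giS i j = giS j i.
Proof.
transitivity (\sum_k \sum_l giS i l * gS l k * giS j k); last first.
  transitivity (\sum_k (i == k)%:R * giS j k); last by rewrite sum_delta.
  by apply: eq_bigr => k _; rewrite -giSK mulr_suml.
rewrite exchange_big /=.
transitivity (\sum_l (j == l)%:R * giS i l); first by rewrite sum_delta.
apply: eq_bigr => l _; rewrite -giSK mulr_suml; apply: eq_bigr => k _.
by rewrite (gSC l k); ring.
Qed.

Lemma sder_lin (F : E -> R) (hF : smooth_on Odom F) v :
  (forall a x y, F (a *: x + y) = a * F x + F y) ->
  sder v (mkS Odom_open hF) = sconst Odom_open (F v).
Proof.
move=> lF; apply: sfunP => z Oz; rewrite sconstE //.
rewrite (@sder_eq _ _ _ _ v _ F z Oz); last by move=> y Oy; exact: mkSE.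
by have [_ ->] := is_derive_lin z v lF.
Qed.

Lemma sder_lift0 F (hF : smooth_on (I `*` U) F) v : v.1 = 0 ->
  sder v (liftS hF) = 0.
Proof.
move=> v0; apply: sfunP => z Oz; rewrite sfun0.
rewrite (@sder_eq _ _ _ _ v _ (fun z => F z.1) z Oz); last first.
  by move=> y Oy; exact: mkSE.
have -> : 'D_v (fun z : E => F z.1) z = 'D_(v.1) F z.1 by [].
by rewrite v0 derive0.
Qed.

Lemma sconst0 : sconst Odom_open 0 = 0.
Proof. by []. Qed.
Lemma sconst_bool (b : bool) : sconst Odom_open b%:R = b%:R.
Proof. by case: b. Qed.

Let half : B := sconst Odom_open 2^-1.
Lemma halfE : half * 2 = 1.
Proof.
apply: sfunP => z Oz; rewrite mulr2n sfunM // sfunD // sfun1 // sconstE //.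
by rewrite -mulr2n mulVf // pnatr_eq0.
Qed.

Lemma sder_eS v a i : sder v (eS a i) = sconst Odom_open (v.2 a i).
Proof. exact: (sder_lin _ v (frame_lin a i)). Qed.
Lemma sder_zS v i : sder v (zS i) = sconst Odom_open (v.1.2 0 i).
Proof. exact: (sder_lin _ v (coord_lin i)). Qed.

Lemma dt_eS a i : sder dirt (eS a i) = 0.
Proof. by rewrite sder_eS mxE sconst0. Qed.
Lemma dx_eS j a i : sder (dirx j) (eS a i) = 0.
Proof. by rewrite sder_eS mxE sconst0. Qed.
Lemma dv_eS b k a i : sder (dirv b k) (eS a i) = (a == b)%:R * (i == k)%:R.
Proof. by rewrite sder_eS mxE sconst_bool -natrM mulnb. Qed.
Lemma dx_zS i j : sder (dirx i) (zS j) = (j == i)%:R.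
Proof. by rewrite sder_zS mxE eqxx /= sconst_bool. Qed.
Lemma dv_zS b k j : sder (dirv b k) (zS j) = 0.
Proof. by rewrite sder_zS mxE sconst0. Qed.
Lemma dv_gS b k i j : sder (dirv b k) (gS i j) = 0.
Proof. exact: sder_lift0. Qed.
Lemma dv_fS b k : sder (dirv b k) fS = 0.
Proof. exact: sder_lift0. Qed.
Lemma dv_giS b k i j : sder (dirv b k) (giS i j) = 0.
Proof.
rewrite (der_inverse _ _ (sder_der Odom_open (dirv b k)) gSK giSK).
rewrite big1 ?oppr0 // => p _; rewrite big1 // => q _.
by rewrite dv_gS mulr0 mul0r.
Qed.

Definition bundleS : frame_bundle B n := @FrameBundle B n
  (sder dirt) (fun i => sder (dirx i)) (fun b k => sder (dirv b k))
  zS eS thS gS giS half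
  (sder_der _ _) (fun i => sder_der _ _) (fun b k => sder_der _ _)
  (fun i u => sderC _ _ u) (fun b k u => sderC _ _ u) (fun i j u => sderC _ _ u)
  (fun i b k u => sderC _ _ u) (fun b k c l u => sderC _ _ u)
  dx_zS dv_zS dt_eS dx_eS dv_eS eS_th thS_e gSC giSC gSK dv_gS dv_giS halfE.

Definition rep (F : R -> 'rV[R]_n -> R) (b : B) :=
  forall z, Odom z -> b z = F z.1.1 z.1.2.

Local Notation P := bundleS.

(** * Components of tensor fields as functions on the frame bundle *)

(** A function that does not depend on e has no vertical derivative. *)
Lemma rep_basic F b : rep F b -> basic P b.
Proof.
move=> h c k; apply: sfunP => z Oz; rewrite sfun0 -[LHS]/(sder (dirv c k) b z).
rewrite (@sder_eq _ _ _ _ _ b (fun z => F z.1.1 z.1.2) z Oz h).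
have -> : 'D_(dirv c k) (fun z : E => F z.1.1 z.1.2) z =
    'D_0 (fun w : R * 'rV[R]_n => F w.1 w.2) z.1 by [].
exact: derive0.
Qed.

(** A function on the base has the same partial derivatives on the bundle. *)
Lemma rep_dx F b i : rep F b ->
  rep (fun s y => pd i (F s) y) (bx P i b).
Proof.
move=> h z Oz.
rewrite -[LHS]/(sder (dirx i) b z) (@sder_eq _ _ _ _ _ b (fun z => F z.1.1 z.1.2) z Oz h).
have e : (fun k : R => k^-1 *: (((fun z : E => F z.1.1 z.1.2) \o shift z)
     (k *: dirx i) - F z.1.1 z.1.2)) =
   (fun k : R => k^-1 *: ((F z.1.1 \o shift z.1.2) (k *: delta_mx 0 i)
     - F z.1.1 z.1.2)).
  by apply/funext => k /=; rewrite scaler0 add0r.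
by rewrite /pd /derive e.
Qed.

Lemma rep_dt F b z : rep F b -> Odom z ->
  is_derive z.1.1 (1 : R) (fun s => F s z.1.2) (bt P b z).
Proof.
move=> h Oz.
have e : (fun k : R => k^-1 *: (((fun z : E => F z.1.1 z.1.2) \o shift z)
     (k *: dirt) - F z.1.1 z.1.2)) =
   (fun k : R => k^-1 *: (((fun s => F s z.1.2) \o shift z.1.1) (k *: (1 : R))
     - F z.1.1 z.1.2)).
  by apply/funext => k /=; rewrite scaler0 add0r.
have nb : {near z, b =1 (fun z : E => F z.1.1 z.1.2)}.
  exact: (near_eq_on Odom_open h Oz).
have db : derivable b z dirt := @smooth_derivable _ _ _ b dirt z (sfun_smooth b) Oz.
split.
  by have := near_eq_derivable nb db; rewrite /derivable e.
rewrite -[RHS]/(sder dirt b z) (@sder_eq _ _ _ _ _ b (fun z => F z.1.1 z.1.2) z Oz h).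
by rewrite /derive e.
Qed.

Lemma repD F F' b b' : rep F b -> rep F' b' ->
  rep (fun s y => F s y + F' s y) (b + b').
Proof. by move=> h h' z Oz; rewrite sfunD // h // h'. Qed.
Lemma repM F F' b b' : rep F b -> rep F' b' ->
  rep (fun s y => F s y * F' s y) (b * b').
Proof. by move=> h h' z Oz; rewrite sfunM // h // h'. Qed.
Lemma repB F F' b b' : rep F b -> rep F' b' ->
  rep (fun s y => F s y - F' s y) (b - b').
Proof. by move=> h h' z Oz; rewrite sfunB // h // h'. Qed.
Lemma rep_sum (T : finType) (F : T -> R -> 'rV[R]_n -> R) b :
  (forall i, rep (F i) (b i)) ->
  rep (fun s y => \sum_i F i s y) (\sum_i b i).
Proof.
by move=> h z Oz; rewrite sfun_sum //; apply: eq_bigr => i _; rewrite h.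
Qed.
Lemma rep_const a : rep (fun _ _ => a) (sconst Odom_open a).
Proof. by move=> z Oz; rewrite sconstE. Qed.

Lemma rep_g i j : rep (fun s y => g s y i j) (gS i j).
Proof. by move=> z Oz; rewrite gSE. Qed.

Lemma rep_f : rep f fS.
Proof. by move=> z Oz; rewrite fSE. Qed.

(** Inverse matrices are unique. *)
Lemma rep_gi i j : rep (fun s y => ginv (g s) y i j) (giS i j).
Proof.
move=> z Oz; have [Iz Uz _] := Oz.
pose A := \matrix_(a, b) g z.1.1 z.1.2 a b.
pose A' := \matrix_(a, b) giS a b z.
have AA' : A *m A' = 1%:M.
  apply/matrixP => a b; rewrite !mxE.
  have := congr1 (fun u : B => u z) (gSK a b); rewrite /= sfun_sum //.
  rewrite (_ : ((a == b)%:R : B) z = (a == b)%:R); last first.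
    by case: (a == b); rewrite ?sfun1 ?sfun0.
  move=> <-; apply: eq_bigr => k _; rewrite !mxE sfunM // gSE //.
have AU : A \in unitmx := g_unit Iz Uz.
rewrite /ginv -/A.
have -> : invmx A = A' by rewrite -[RHS](mulKmx AU) AA' mulmx1.
by rewrite mxE.
Qed.

Lemma rep_chr k i j : rep (fun s y => christoffel (g s) y k i j) (chris P k i j).
Proof.
apply: repM; first exact: rep_const.
apply: rep_sum => l; apply: repM; first exact: rep_gi.
by apply: repB; [apply: repD|]; apply: rep_dx; exact: rep_g.
Qed.

Lemma rep_nab1 w b i j : (forall k, rep (fun s y => w s y k) (b k)) ->
  rep (fun s y => nabla1 (g s) (w s) y i j) (nab1 P b i j).
Proof.
move=> h; apply: repB; first exact: rep_dx.
by apply: rep_sum => m; apply: repM => //; exact: rep_chr.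
Qed.

Lemma rep_nab2 T b i j k : (forall k l, rep (fun s y => T s y k l) (b k l)) ->
  rep (fun s y => nabla2 (g s) (T s) y i j k) (nab2 P b i j k).
Proof.
move=> h; apply: repB; first apply: repB; first exact: rep_dx.
  by apply: rep_sum => m; apply: repM => //; exact: rep_chr.
by apply: rep_sum => m; apply: repM => //; exact: rep_chr.
Qed.

Lemma rep_nab3 T b i j k l :
  (forall k l m, rep (fun s y => T s y k l m) (b k l m)) ->
  rep (fun s y => nabla3 (g s) (T s) y i j k l) (nab3 P b i j k l).
Proof.
move=> h; do 2!(apply: repB; last by
  apply: rep_sum => m; apply: repM => //; exact: rep_chr).
apply: repB; first exact: rep_dx.
by apply: rep_sum => m; apply: repM => //; exact: rep_chr.
Qed.

Lemma rep_curv i j k l :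
  rep (fun s y => curv (g s) y i j k l) (curv_coef P i j k l).
Proof.
have hc := rep_chr.
apply: repD; first by apply: repB; exact: rep_dx.
by apply: rep_sum => m; apply: repB; exact: repM.
Qed.

Definition dfB (b : B) i := bx P i b.

Lemma rep_df u b i : rep u b -> rep (fun s y => df (u s) y i) (dfB b i).
Proof. exact: rep_dx. Qed.

Lemma rep_hess u b i j : rep u b ->
  rep (fun s y => hess (g s) (u s) y i j) (nab1 P (dfB b) i j).
Proof. by move=> h; apply: rep_nab1 => k; exact: rep_df. Qed.

Definition coord_tr (T : 'I_n -> 'I_n -> B) := \sum_i \sum_j giS i j * T i j.

Lemma rep_tr T b : (forall i j, rep (fun s y => T s y i j) (b i j)) ->
  rep (fun s y => tr (ginv (g s) y) (T s y)) (coord_tr b).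
Proof.
move=> h; apply: rep_sum => i; apply: rep_sum => j; apply: repM => //.
exact: rep_gi.
Qed.

Lemma rep_rm p j k q : rep (fun s y => rm (g s) y p j k q)
  (\sum_l gS q l * curv_coef P p j k l).
Proof.
apply: rep_sum => l; apply: repM; [exact: rep_g|exact: rep_curv].
Qed.

Lemma rep_ric j k : rep (fun s y => ric (g s) y j k) (ric_coef P j k).
Proof.
have -> : ric_coef P j k = coord_tr (fun p q => \sum_l gS q l * curv_coef P p j k l).
  apply: eq_bigr => p _.
  rewrite -[LHS](sum_delta p (curv_coef P p j k)).
  under [RHS]eq_bigr => q _ do rewrite mulr_sumr.
  rewrite exchange_big; apply: eq_bigr => l _; rewrite -giSK mulr_suml.
  by apply: eq_bigr => q _; rewrite mulrA.
by apply: rep_tr => p q; exact: rep_rm.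
Qed.

Local Notation F := (calculus P).
Variables (t : R) (x : 'rV[R]_n) (It : I t) (Ux : U x).
Let z0 : E := ((t, x), 1%:M).

(** * Evaluation at the coordinate frame *)
Lemma Oz0 : Odom z0. Proof. by split=> //; exact: unitmx1. Qed.
Local Hint Resolve Oz0 : core.

Lemma ev_nat k : (k%:R : B) z0 = k%:R.
Proof.
elim: k => [|k IH]; first by rewrite sfun0.
have -> : (k.+1%:R : B) = 1 + k%:R by exact: mulrS.
by rewrite sfunD // sfun1 // IH [RHS]mulrS.
Qed.

Lemma ev_lift1 a X : lift1 P a X z0 = X a z0.
Proof.
rewrite sfun_sum //.
transitivity (\sum_i (a == i)%:R * X i z0); last by rewrite sum_delta.
by apply: eq_bigr => i _; rewrite sfunM // eSE // mxE mulrb.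
Qed.

Lemma ev_lift2 T a b : lift2 P T a b z0 = T a b z0.
Proof. by rewrite !ev_lift1. Qed.
Lemma ev_lift3 T a b c : lift3 P T a b c z0 = T a b c z0.
Proof. by rewrite !ev_lift1. Qed.
Lemma ev_lift4 T a b c d : lift4 P T a b c d z0 = T a b c d z0.
Proof. by rewrite !ev_lift1. Qed.

Lemma ev_th i a : thS i a z0 = (i == a)%:R.
Proof.
have := congr1 (fun u : B => u z0) (eS_th i a) => /=.
rewrite ev_nat => <-; rewrite -[lift1 P i (thS^~ a) z0]/(_) -/(lift1 P i (thS^~ a)).
by rewrite ev_lift1.
Qed.

Local Notation gi := (ginv (g t) x).

Lemma ev_gi p q : fgi F p q z0 = gi p q.
Proof.
rewrite -(rep_gi p q Oz0) sfun_sum //.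
transitivity (\sum_i (p == i)%:R * \sum_j (q == j)%:R * giS i j z0); last first.
  by rewrite !sum_delta.
apply: eq_bigr => i _; rewrite sfun_sum // mulr_sumr; apply: eq_bigr => j _.
by rewrite !sfunM // !ev_th mulrA (eq_sym p) (eq_sym q).
Qed.

Lemma ev_mtr X : mtr F X z0 = tr gi (fun p q => X p q z0).
Proof.
rewrite sfun_sum //; apply: eq_bigr => p _; rewrite sfun_sum //.
by apply: eq_bigr => q _; rewrite sfunM // ev_gi.
Qed.

Definition conR (v w : 'I_n -> R) := tr gi (fun p q => v p * w q).

Lemma ev_con v w : con F v w z0 = conR (v^~ z0) (w^~ z0).
Proof.
rewrite ev_mtr; apply: eq_bigr => p _; apply: eq_bigr => q _.
by rewrite sfunM.
Qed.

Lemma conRC v w : conR v w = conR w v.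
Proof.
rewrite /conR /tr exchange_big; apply: eq_bigr => p _; apply: eq_bigr => q _.
by rewrite -!ev_gi (fgiC F q p); congr (_ * _); exact: mulrC.
Qed.

Lemma ev_dt T a b : ft F (lift2 P T a b) z0 = (bt P (T a b)) z0.
Proof.
rewrite -[ft F _]/(bt P (lift1 P a (fun i => lift1 P b (T i)))).
by rewrite bt_lift1 ev_lift1 bt_lift1 ev_lift1.
Qed.

(** The relation between a time-dependent tensor field given in coordinates and
   the family of its frame components. The operations of the frame calculus
   respect it, and at e = 1 both sides have the same values. *)
Definition tensor_rep (T : 'I_n -> 'I_n -> B) (Ts : R -> 'rV[R]_n -> 'I_n -> 'I_n -> R) :=
  exists2 TB, T =2 lift2 P TB & forall i j, rep (fun s y => Ts s y i j) (TB i j).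

Lemma tensor_val T Ts a b : tensor_rep T Ts -> T a b z0 = Ts t x a b.
Proof. by move=> [TB e r]; rewrite e ev_lift2 (r a b _ Oz0). Qed.

Lemma tensor_D T Ts m j k : tensor_rep T Ts ->
  fD F m (T j k) z0 = nabla2 (g t) (Ts t) x m j k.
Proof.
move=> [TB e r]; rewrite e /= D_lift2 => [|i j']; last exact: rep_basic (r i j').
by rewrite ev_lift3 (rep_nab2 m j k r Oz0).
Qed.

Lemma tensor_lap T Ts j k : tensor_rep T Ts ->
  lap F T j k z0 = laplace2 (g t) (Ts t) x j k.
Proof.
move=> [TB e r]; rewrite ev_mtr; apply: eq_bigr => p _; apply: eq_bigr => q _.
rewrite e /= D_lift2 => [|i j']; last exact: rep_basic (r i j').
have r2 a b c := rep_nab2 a b c r.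
rewrite D_lift3 => [|a b c]; last exact: rep_basic (r2 a b c).
by rewrite ev_lift4 (rep_nab3 p q j k r2 Oz0).
Qed.

Lemma tensor_dt T Ts j k : tensor_rep T Ts ->
  is_derive t (1 : R) (fun s => Ts s x j k) (ft F (T j k) z0).
Proof.
move=> [TB e r]; rewrite e ev_dt; exact: (rep_dt (r j k) Oz0).
Qed.

Lemma scalar_D u b p : rep u b -> fD F p b z0 = df (u t) x p.
Proof.
move=> r; rewrite /= (D_basic _ (rep_basic r)) ev_lift1.
by rewrite (rep_dx p r Oz0).
Qed.

Lemma scalar_grad u b p : rep u b -> hder P p b = lift1 P p (dfB b).
Proof. by move=> r; rewrite (D_basic _ (rep_basic r)). Qed.

Lemma scalar_hess u b : rep u b ->
  tensor_rep (fun p q => fD F p (fD F q b)) (fun s y => hess (g s) (u s) y).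
Proof.
move=> r; exists (nab1 P (dfB b)) => [p q|i j]; last exact: rep_hess.
rewrite /= (scalar_grad q r) D_lift1 // => j.
exact: rep_basic (rep_dx j r).
Qed.

Lemma scalar_lap u b : rep u b ->
  mtr F (fun p q => fD F p (fD F q b)) z0 = laplace0 (g t) (u t) x.
Proof.
move=> r; rewrite ev_mtr; apply: eq_bigr => p _; apply: eq_bigr => q _.
by rewrite (tensor_val p q (scalar_hess r)).
Qed.

Lemma scalar_tr T Ts : tensor_rep T Ts ->
  rep (fun s y => tr (ginv (g s) y) (Ts s y)) (mtr F T).
Proof.
move=> [TB e r]; rewrite (eq_mtr F e) mtr_lift2; exact: rep_tr.
Qed.

Lemma tensor_ric : tensor_rep (ricci F) (fun s y => ric (g s) y).
Proof.
exists (ric_coef P) => [a b|i j]; first exact: ric_Rup.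
exact: rep_ric.
Qed.

Lemma tensor_prod u b : rep u b ->
  tensor_rep (fun p q => fD F p b * fD F q b)
    (fun s y i j => df (u s) y i * df (u s) y j).
Proof.
move=> r; exists (fun i j => dfB b i * dfB b j) => [p q|i j]; last first.
  by apply: repM; exact: rep_df.
rewrite /= !(scalar_grad _ r) {1}/lift1 mulr_suml; apply: eq_bigr => i _.
by rewrite lift1Z mulrA.
Qed.

Lemma tensorD T T' Ts Ts' : tensor_rep T Ts -> tensor_rep T' Ts' ->
  tensor_rep (fun p q => T p q + T' p q) (fun s y i j => Ts s y i j + Ts' s y i j).
Proof.
move=> [TB e r] [TB' e' r'].
exists (fun i j => TB i j + TB' i j) => [p q|i j]; last exact: repD.
rewrite e e' -lift1D; apply: eq_lift1 => i; by rewrite -lift1D.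
Qed.

Lemma tensorZ k T Ts : tensor_rep T Ts ->
  tensor_rep (fun p q => sconst Odom_open k * T p q) (fun s y i j => k * Ts s y i j).
Proof.
move=> [TB e r].
exists (fun i j => sconst Odom_open k * TB i j) => [p q|i j]; last first.
  by apply: repM => //; exact: rep_const.
by rewrite e -lift1Z; apply: eq_lift1 => i; rewrite -lift1Z.
Qed.

Variable N : \bar R.
Local Notation c := (dim_coef n N).
Let cB : B := sconst Odom_open c.

Lemma tensor_bakry : tensor_rep (bakry F fS cB)
  (fun s y => bakry_emery N (g s) (f s) y).
Proof.
have h1 := tensor_ric; have h2 := scalar_hess rep_f.
have [TB e r] := tensorD (tensorD h1 h2) (tensorZ (- c) (tensor_prod rep_f)).
exists TB => [a b|i j]; last first.
  move=> z Oz; rewrite (r i j z Oz) /bakry_emery mulNr; ring.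
rewrite -e /bakry; congr (_ + _).
by rewrite -mulNr; congr (_ * _); apply: sfunP => z Oz; rewrite sfunN // !sconstE.
Qed.

Hypothesis flow_g : forall s y, I s -> U y -> forall i j,
  is_derive s (1 : R) (fun r => g r y i j)
    (- 2 * bakry_emery N (g s) (f s) y i j).
Hypothesis flow_f : forall s y, I s -> U y ->
  is_derive s (1 : R) (fun r => f r y) (drift_laplace0 (g s) (f s) (f s) y).

Local Notation D := (fD F).
Local Notation v := (fun a => D a fS).
Local Notation H := (fun a b => D a (D b fS)).
Local Notation X := (bakry F fS cB).
Local Notation N2 := (con F v v).

(** * The evolution formulas *)
Lemma sum_mul_sharp (h : 'I_n -> 'I_n -> R) (a w : 'I_n -> R) :
  \sum_(p < n) a p * sharp h w p = tr h (fun p q => a p * w q).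
Proof.
apply: eq_bigr => p _; rewrite mulr_sumr; apply: eq_bigr => q _.
by rewrite mulrCA.
Qed.

Lemma sum_sharp_mul (h : 'I_n -> 'I_n -> R) (a w : 'I_n -> R) :
  \sum_(p < n) sharp h w p * a p = tr h (fun p q => a p * w q).
Proof.
by rewrite -sum_mul_sharp; apply: eq_bigr => p _; rewrite mulrC.
Qed.

Lemma rep_grad_norm2 : rep (fun s y => grad_norm2 (g s) (f s) y) N2.
Proof.
move=> z Oz; rewrite (scalar_tr (tensor_prod rep_f) Oz).
by rewrite /grad_norm2 /ip1 sum_mul_sharp.
Qed.

Lemma rep_lapF : rep (fun s y => laplace0 (g s) (f s) y) (mtr F H).
Proof. exact: (scalar_tr (scalar_hess rep_f)). Qed.

Lemma rep_drift : rep (fun s y => drift_laplace0 (g s) (f s) (f s) y)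
  (mtr F H - N2).
Proof. exact: (repB rep_lapF rep_grad_norm2). Qed.

Lemma rep_bt u b w b' : rep u b -> rep w b' ->
  (forall s y, I s -> U y -> is_derive s (1 : R) (u^~ y) (w s y)) ->
  bt P b = b'.
Proof.
move=> r r' h; apply: sfunP => z Oz; have [Iz Uz _] := Oz.
have [_ <-] := rep_dt r Oz; rewrite (r' z Oz).
by have [_ ->] := h _ _ Iz Uz.
Qed.

Lemma dt_fS : ft F fS = mtr F H - N2.
Proof. exact: (rep_bt rep_f rep_drift flow_f). Qed.

(** The flow equation for the metric, read on the frame bundle. *)
Lemma dt_gS a b : ft F (fg F a b) = - 2 * X a b.
Proof.
have [TB e r] := tensor_bakry.
rewrite e -lift1Z -[ft F _]/(bt P (lift1 P a (fun i => lift1 P b (gS i)))) bt_lift1.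
apply: eq_lift1 => i; rewrite bt_lift1 -lift1Z; apply: eq_lift1 => j.
apply: (rep_bt (rep_g i j) (w := fun s y => - 2 * bakry_emery N (g s) (f s) y i j)).
  move=> z Oz; rewrite sfunM // (r i j z Oz); congr (_ * _).
  rewrite sfunN // mulr2n sfunD // sfun1 //.
by move=> s y Is Uy; exact: flow_g.
Qed.

Lemma scalar_fS : is_scalar F fS.
Proof. by move=> a b; apply: E_basic; exact: dv_fS. Qed.

Lemma D_const k a : D a (sconst Odom_open k) = 0.
Proof.
rewrite /= /hder /vf big1 // => s _.
have -> : bpd P s (sconst Odom_open k) = 0.
  by case: s => [i|[b l]]; exact: sder_const.
by rewrite mulr0.
Qed.

Lemma dt_const k : ft F (sconst Odom_open k) = 0.
Proof. exact: sder_const. Qed.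

Definition dt_ricS := @dt_ric_flow _ _ F fS scalar_fS cB (D_const c) dt_gS.
Definition dt_beS := @dt_bakry_flow _ _ F fS scalar_fS cB (D_const c) (dt_const c) dt_gS dt_fS.
Definition dt_scalS := @dt_bakry_trace _ _ F fS scalar_fS cB (D_const c) (dt_const c) dt_gS dt_fS.
Definition dt_tildeS k := @dt_tilde _ _ F fS scalar_fS cB (D_const c) (dt_const c) dt_gS dt_fS
  (sconst Odom_open k) (D_const k) (dt_const k).

Lemma ev_riem p j k q : riem F p j k q z0 = rm (g t) x p j k q.
Proof. by rewrite riem_lift4 ev_lift4 (rep_rm p j k q Oz0). Qed.

Lemma ev_riemQ T Ts j k : tensor_rep T Ts -> riemQ F T j k z0 =
  \sum_(p < n) \sum_(q < n) rm (g t) x p j k q * up2 gi (Ts t x) p q.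
Proof.
move=> r; rewrite ev_mtr; apply: eq_bigr => p _.
transitivity (\sum_a \sum_q \sum_b gi p a * gi q b * rm (g t) x p j k q * Ts t x a b).
  apply: eq_bigr => a _; rewrite ev_con mulr_sumr; apply: eq_bigr => q _.
  rewrite mulr_sumr; apply: eq_bigr => b _.
  by rewrite ev_riem (tensor_val a b r); ring.
rewrite exchange_big; apply: eq_bigr => q _; rewrite mulr_sumr.
apply: eq_bigr => a _; rewrite mulr_sumr; apply: eq_bigr => b _; ring.
Qed.

Lemma ev_con_rows A As T Ts j k : tensor_rep A As -> tensor_rep T Ts ->
  con F (A j) (T k) z0 = \sum_(p < n) up1 gi (Ts t x) k p * As t x j p.
Proof.
move=> rA rT; rewrite ev_con.
rewrite /conR -(sum_sharp_mul gi (fun p => A j p z0) (fun q => T k q z0)).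
apply: eq_bigr => p _; rewrite (tensor_val j p rA); congr (_ * _).
by apply: eq_bigr => q _; rewrite (tensor_val k q rT).
Qed.

Local Notation dF := (df (f t) x).
Local Notation Ric := (ric (g t)).
Local Notation RicN := (bakry_emery N (g t) (f t)).
Local Notation HessF := (hess (g t) (f t) x).

Lemma ev_v p : D p fS z0 = dF p.
Proof. exact: scalar_D rep_f. Qed.

Lemma ev_con_D T Ts j k : tensor_rep T Ts ->
  con F (fun m => D m (T j k)) v z0 =
  \sum_(l < n) sharp gi (fun m => nabla2 (g t) (Ts t) x m j k) l * dF l.
Proof.
move=> r; rewrite ev_con conRC sum_sharp_mul.
apply: eq_bigr => p _; apply: eq_bigr => q _.
by rewrite ev_v (tensor_D q j k r).
Qed.

Lemma ev_con_v T Ts j : tensor_rep T Ts ->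
  con F (T j) v z0 = \sum_(p < n) Ts t x j p * grad (g t) (f t) x p.
Proof.
move=> r; rewrite ev_con sum_mul_sharp.
apply: eq_bigr => p _; apply: eq_bigr => q _.
by rewrite ev_v (tensor_val j p r).
Qed.

Lemma tensor_sym T Ts a b : tensor_rep T Ts -> symm T -> Ts t x a b = Ts t x b a.
Proof. by move=> r s; rewrite -!(tensor_val _ _ r) s. Qed.

Lemma ev_con_sym T Ts j k : tensor_rep T Ts -> symm T ->
  con F (T j) (T k) z0 = \sum_(p < n) up1 gi (Ts t x) j p * Ts t x p k.
Proof.
move=> r s; rewrite conC (ev_con_rows k j r r).
by apply: eq_bigr => p _; rewrite (tensor_sym k p r s).
Qed.

Lemma ev_con_hess j k : con F (H j) (H k) z0 =
  \sum_(p < n) HessF p j * sharp gi (fun q => HessF q k) p.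
Proof.
have r := scalar_hess rep_f; have s := hessC scalar_fS.
rewrite ev_con sum_mul_sharp; apply: eq_bigr => p _; apply: eq_bigr => q _.
by rewrite -!(tensor_val _ _ r) s (s k).
Qed.

Lemma ev_riemdf j k : riemdf F fS j k z0 =
  \sum_(p < n) \sum_(l < n)
     rm_up (g t) x p j k l * dF l * grad (g t) (f t) x p.
Proof.
under [RHS]eq_bigr => p _ do rewrite -mulr_suml.
rewrite (sum_mul_sharp gi (fun p => \sum_l rm_up (g t) x p j k l * dF l) dF).
rewrite ev_con; apply: eq_bigr => p _; apply: eq_bigr => q _.
rewrite ev_v; congr (_ * (_ * _)); rewrite ev_con conRC.
rewrite (sum_sharp_mul gi dF (rm (g t) x p j k)).
apply: eq_bigr => a _; apply: eq_bigr => b _.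
by rewrite ev_v ev_riem.
Qed.

Let ev (u : B) := u z0.
Let evD (u w : B) : ev (u + w) = ev u + ev w. Proof. exact: (sfunD u w Oz0). Qed.
Let evM (u w : B) : ev (u * w) = ev u * ev w. Proof. exact: (sfunM u w Oz0). Qed.
Let evN (u : B) : ev (- u) = - ev u. Proof. exact: (sfunN u Oz0). Qed.

Lemma ev_c k : sconst Odom_open k z0 = k.
Proof. exact: (sconstE Odom_open k Oz0). Qed.

Lemma evolution_ric j k : is_derive t (1 : R) (fun s => ric (g s) x j k)
  (laplace2 (g t) Ric x j k
   + 2 * \sum_(p < n) \sum_(q < n) rm (g t) x p j k q * up2 gi (Ric x) p q
   - 2 * \sum_(p < n) up1 gi (Ric x) j p * Ric x p k
   - \sum_(l < n) sharp gi (fun m => nabla2 (g t) Ric x m j k) l * dF l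
   - \sum_(l < n) up1 gi (Ric x) j l * HessF k l
   - \sum_(l < n) up1 gi (Ric x) k l * HessF j l
   + 2 * c *
     (laplace0 (g t) (f t) x * HessF j k
      - \sum_(p < n) HessF p j * sharp gi (fun q => HessF q k) p
      - \sum_(p < n) \sum_(l < n)
          rm_up (g t) x p j k l * dF l * grad (g t) (f t) x p)).
Proof.
have rR := tensor_ric; have rH := scalar_hess rep_f.
apply: (is_derive_eq (tensor_dt j k rR)).
rewrite dt_ricS.
have e1 := conC F (ricci F j) (H k).
have e2 := conC F (ricci F k) (H j).
apply: (eval_ric evD evM evN ev_nat (ev_c c) (tensor_lap j k rR)
  (ev_riemQ j k rR) (ev_con_sym j k rR (ricciC F)) (ev_con_D j k rR)
  (etrans (congr1 ev e1) (ev_con_rows k j rH rR))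
  (etrans (congr1 ev e2) (ev_con_rows j k rH rR))
  (rep_lapF Oz0) (tensor_val j k rH) (ev_con_hess j k) (ev_riemdf j k)).
Qed.

Lemma sum_ip2 A T As Ts : tensor_rep A As -> tensor_rep T Ts ->
  inner F A T z0 = ip2 gi (Ts t x) (As t x).
Proof.
move=> rA rT; rewrite ev_mtr; apply: eq_bigr => p _.
transitivity (\sum_a \sum_q \sum_b gi p a * gi q b * Ts t x a b * As t x p q).
  apply: eq_bigr => a _; rewrite ev_con mulr_sumr; apply: eq_bigr => q _.
  rewrite mulr_sumr; apply: eq_bigr => b _.
  by rewrite (tensor_val p q rA) (tensor_val a b rT); ring.
rewrite exchange_big; apply: eq_bigr => q _; rewrite mulr_suml.
by apply: eq_bigr => a _; rewrite mulr_suml.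
Qed.

Lemma bakryC : symm X.
Proof.
move=> a b; rewrite /bakry ricciC (hessC scalar_fS); congr (_ - _).
by congr (_ * _); exact: mulrC.
Qed.

Lemma evolution_bakry_emery j k : is_derive t (1 : R) (fun s => bakry_emery N (g s) (f s) x j k)
  (laplace2 (g t) RicN x j k
   + 2 * \sum_(p < n) \sum_(q < n) rm (g t) x p j k q * up2 gi (RicN x) p q
   - 2 * \sum_(p < n) up1 gi (RicN x) j p * RicN x p k
   - \sum_(l < n) sharp gi (fun m => nabla2 (g t) RicN x m j k) l * dF l
   - c * ((\sum_(p < n) RicN x j p * grad (g t) (f t) x p) * dF k
          + (\sum_(p < n) RicN x k p * grad (g t) (f t) x p) * dF j
          - 2 * (laplace0 (g t) (f t) x - grad_norm2 (g t) (f t) x)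
            * HessF j k)).
Proof.
have rX := tensor_bakry; have rH := scalar_hess rep_f.
apply: (is_derive_eq (tensor_dt j k rX)).
rewrite dt_beS.
apply: (eval_bakry evD evM evN ev_nat (ev_c c) (tensor_lap j k rX)
  (ev_riemQ j k rX) (ev_con_sym j k rX bakryC) (ev_con_D j k rX)
  (ev_con_v j rX) (ev_v k) (ev_con_v k rX) (ev_v j)
  (rep_lapF Oz0) (rep_grad_norm2 Oz0) (tensor_val j k rH)).
Qed.

Lemma ev_grad_con u b : rep u b ->
  con F (fun p => D p b) v z0 = \sum_(p < n) dF p * grad (g t) (u t) x p.
Proof.
move=> r; rewrite ev_con conRC sum_mul_sharp.
apply: eq_bigr => p _; apply: eq_bigr => q _.
by rewrite ev_v (scalar_D q r).
Qed.

Lemma rep_scal : rep (fun s y => bakry_emery_scal N (g s) (f s) y) (mtr F X).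
Proof. exact: (scalar_tr tensor_bakry). Qed.

Lemma evolution_bakry_emery_scal : is_derive t (1 : R)
  (fun s => bakry_emery_scal N (g s) (f s) x)
  (laplace0 (g t) (bakry_emery_scal N (g t) (f t)) x
   + 2 * ip2 gi (RicN x) (RicN x) - 2 * ip2 gi (RicN x) HessF
   - \sum_(p < n) dF p * grad (g t) (bakry_emery_scal N (g t) (f t)) x p
   + 2 * c * laplace0 (g t) (f t) x
     * (laplace0 (g t) (f t) x - grad_norm2 (g t) (f t) x)).
Proof.
have rX := tensor_bakry; have rH := scalar_hess rep_f.
apply: (is_derive_eq (rep_dt rep_scal Oz0)).
rewrite -[bt P _]/(ft F (mtr F X)) dt_scalS.
apply: (eval_scal evD evM evN ev_nat (ev_c c) (scalar_lap rep_scal)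
  (sum_ip2 rX rX) (etrans (congr1 ev (innerC F X H)) (sum_ip2 rH rX))
  (ev_grad_con rep_scal) (rep_lapF Oz0) (rep_grad_norm2 Oz0)).
Qed.

Lemma rep_tilde k : rep (fun s y => tilde_scal N k (g s) (f s) y)
  (mtr F X + (mtr F H - N2) - sconst Odom_open k * N2).
Proof.
apply: repB; first exact: repD rep_scal rep_drift.
exact: repM (rep_const k) rep_grad_norm2.
Qed.

Lemma evolution_tilde_scal k : is_derive t (1 : R)
  (fun s => tilde_scal N k (g s) (f s) x)
  (drift_laplace0 (g t) (f t) (tilde_scal N k (g t) (f t)) x
   + 2 * ip2 gi (RicN x) (RicN x)
   + 2 * c * (laplace0 (g t) (f t) x - grad_norm2 (g t) (f t) x) ^+ 2
   + 2 * k * ip2 gi HessF HessF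
   + 2 * k * c * grad_norm2 (g t) (f t) x ^+ 2).
Proof.
have rX := tensor_bakry; have rH := scalar_hess rep_f.
have rT := rep_tilde k.
apply: (is_derive_eq (rep_dt rT Oz0)).
rewrite -[bt P _]/(ft F _) dt_tildeS.
apply: (eval_tilde evD evM evN ev_nat (ev_c c) (ev_c k) (scalar_lap rT)
  (etrans (congr1 ev (conC F v _)) (ev_grad_con rT))
  (sum_ip2 rX rX) (sum_ip2 rH rH) (rep_lapF Oz0) (rep_grad_norm2 Oz0)).
Qed.

Lemma drift_laplace2E T j k :
  laplace2 (g t) T x j k
  - \sum_(p < n) sharp gi (fun m => nabla2 (g t) T x m j k) p * dF p =
  drift_laplace2 (g t) (f t) T x j k.
Proof.
congr (_ - _); rewrite sum_sharp_mul sum_sharp_mul.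
exact: (conRC dF (fun m => nabla2 (g t) T x m j k)).
Qed.
End LocalFlow.

Theorem proposition4p1 (R : realType) (n : nat) (M : smooth_manifold R n)
    (N : \bar R) (N_proper : (-oo < N)%E) (N_neq_n : N != (n%:R)%:E)
    (I : set R) (I_open : open I) (I_interval : is_interval I)
    (g : R -> tensor2 M) (f : R -> M -> R)
    (g_smooth : smooth_metric_family I g)
    (f_smooth : smooth_function_family I f)
    (flow : bakry_emery_flow N I g f)
    (phi : chart R n M) (phi_atlas : atlas phi)
    (t : R) (It : I t) (x : 'rV[R]_n) (phi_x : cimg phi x) :
  let gt := fun s => g s phi in
  let ft := fun s => in_chart (f s) phi in
  let G := gt t in
  let F := ft t in
  let gi := ginv G x in
  let c := dim_coef n N in
  let Rm := rm G x in
  let Ric := ric G in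
  let RicN := bakry_emery N G F in
  let S := bakry_emery_scal N G F in
  let dF := df F x in
  let gradF := grad G F x in
  let HessF := hess G F x in
  let LapF := laplace0 G F x in
  let normF2 := grad_norm2 G F x in
  [/\
    forall j k : 'I_n,
      is_derive t (1 : R) (fun s => ric (gt s) x j k)
        (laplace2 G Ric x j k
         + 2 * \sum_(p < n) \sum_(q < n) Rm p j k q * up2 gi (Ric x) p q
         - 2 * \sum_(p < n) up1 gi (Ric x) j p * Ric x p k
         - \sum_(l < n) sharp gi (fun m => nabla2 G Ric x m j k) l * dF l
         - \sum_(l < n) up1 gi (Ric x) j l * HessF k l
         - \sum_(l < n) up1 gi (Ric x) k l * HessF j l
         + 2 * c *
           (LapF * HessF j k
            - \sum_(p < n) HessF p j * sharp gi (fun q => HessF q k) p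
            - \sum_(p < n) \sum_(l < n) rm_up G x p j k l * dF l * gradF p)),
    forall j k : 'I_n,
      let bracket :=
        \sum_(p < n) RicN x j p * gradF p * dF k
        + \sum_(p < n) RicN x k p * gradF p * dF j
        - 2 * (LapF - normF2) * HessF j k in
      let rhs :=
        laplace2 G RicN x j k
        + 2 * \sum_(p < n) \sum_(q < n) Rm p j k q * up2 gi (RicN x) p q
        - 2 * \sum_(p < n) up1 gi (RicN x) j p * RicN x p k
        - \sum_(p < n) sharp gi (fun m => nabla2 G RicN x m j k) p * dF p
        - c * bracket in
      is_derive t (1 : R) (fun s => bakry_emery N (gt s) (ft s) x j k) rhs /\
      rhs =
        drift_laplace2 G F RicN x j k
        + 2 * \sum_(p < n) \sum_(q < n) Rm p j k q * up2 gi (RicN x) p q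
        - 2 * \sum_(p < n) up1 gi (RicN x) j p * RicN x p k
        - c * bracket,
    let rhs :=
      laplace0 G S x
      + 2 * ip2 gi (RicN x) (RicN x)
      - 2 * ip2 gi (RicN x) HessF
      - \sum_(p < n) dF p * grad G S x p
      + 2 * c * LapF * (LapF - normF2) in
    is_derive t (1 : R) (fun s => bakry_emery_scal N (gt s) (ft s) x) rhs /\
    rhs =
      drift_laplace0 G F S x
      + 2 * ip2 gi (RicN x) (RicN x)
      - 2 * ip2 gi (RicN x) HessF
      + 2 * c * LapF * (LapF - normF2)
    & forall k : R,
      tilde_scal N k G F x = S x + LapF - (k + 1) * normF2 /\
      is_derive t (1 : R) (fun s => tilde_scal N k (gt s) (ft s) x)
        (drift_laplace0 G F (tilde_scal N k G F) x
         + 2 * ip2 gi (RicN x) (RicN x)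
         + 2 * c * (LapF - normF2) ^+ 2
         + 2 * k * ip2 gi HessF HessF
         + 2 * k * c * normF2 ^+ 2)].
Proof.
have [g_riem g_sm] := g_smooth.
have Uo : open (cimg phi) by exact: cimg_open.
pose gc s := g s phi; pose fc s := in_chart (f s) phi.
have g_sym s y : I s -> cimg phi y -> forall i j, gc s y i j = gc s y j i.
  by move=> Is Uy; have [h _] := (g_riem s Is).2 phi phi_atlas y Uy.
have g_unit s y : I s -> cimg phi y -> (\matrix_(i, j) gc s y i j) \in unitmx.
  move=> Is Uy; have [_ h] := (g_riem s Is).2 phi phi_atlas y Uy.
  apply: pos_def_unit => v /h; congr (0 < _).
  by apply: eq_bigr => i _; apply: eq_bigr => j _; rewrite mxE.
have flow_g s y : I s -> cimg phi y -> forall i j,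
    is_derive s (1 : R) (fun r => gc r y i j)
      (- 2 * bakry_emery N (gc s) (fc s) y i j).
  by move=> Is Uy; have [h _] := flow phi phi_atlas s Is y Uy.
have flow_f s y : I s -> cimg phi y ->
    is_derive s (1 : R) (fun r => fc r y) (drift_laplace0 (gc s) (fc s) (fc s) y).
  by move=> Is Uy; have [_ h] := flow phi phi_atlas s Is y Uy.
have gsm := g_sm phi phi_atlas; have fsm := f_smooth phi phi_atlas.
move=> gt ft G F gi c Rm Ric RicN S dF gradF HessF LapF normF2; split.
- move=> j k.
  exact: (evolution_ric I_open Uo gsm g_sym g_unit fsm It phi_x flow_g j k).
- move=> j k bracket rhs; split.
    have h := evolution_bakry_emery I_open Uo gsm g_sym g_unit fsm It phi_x flow_g flow_f j k.
    apply: (is_derive_eq h); rewrite /rhs /bracket.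
    by rewrite -!mulr_suml.
  rewrite /rhs -(drift_laplace2E I_open Uo fc gsm g_sym g_unit It phi_x); ring.
- move=> rhs; split.
    exact: (evolution_bakry_emery_scal I_open Uo gsm g_sym g_unit fsm It phi_x flow_g flow_f).
  rewrite /rhs /drift_laplace0; ring.
- move=> k; split; last first.
    exact: (evolution_tilde_scal I_open Uo gsm g_sym g_unit fsm It phi_x flow_g flow_f k).
  rewrite /tilde_scal /drift_laplace0 -[\sum_(p < n) _]/normF2 -/LapF -/normF2.
  by rewrite -[bakry_emery_scal _ _ _ _]/(S x); ring.
Qed.
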